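(* Let $n\ge 2$, let $\Lambda\subset[-1,1)$ be finite and nonempty, and let $R=(r_1,\dots,r_m)$ be an ordered linearly independent spherical $\Lambda$-code in $S^{n-1}$ with $0\le m\le n-2$ and Gram matrix $G=G_R$. Fix an integer $d\ge0$. With the notation of the context, for a function $F_0:\Omega_R\to\mathbb R$ the following are equivalent. (i) $F_0$ is the restriction to $\Omega_R$ of a real polynomial $F(t,u,v)$ in the variables $t\in\mathbb R$, $u,v\in\mathbb R^m$, of degree at most $d$ in $t$ (with no bound on the degrees in $u,v$), whose restriction to $D_R$ belongs to $\operatorname{PD}(S^{n-1},R)$. (ii) There are real symmetric positive semidefinite matrices $M_{R,0}\succeq0$, with rows and columns indexed by $U_R$, and $M_{R,l}\succeq0$ for $1\le l\le d$, with rows and columns indexed by $U_R^{\mathrm{gen}}$, such that for all $(t,u,v)\in\Omega_R$ $$F_0(t,u,v)=\sum_{l=0}^d P_l^{n,m}(G_R;u,v,t)\,(M_{R,l})_{u,v},$$ where for $l>0$ the $l$-th summand is interpreted as $0$ if $u$ or $v$ is a reference label (one of $Ge_1,\dots,Ge_m$). If $U_R^{\mathrm{gen}}$ is empty, the matrices $M_{R,l}$ with $l>0$ have order zero and all positive-degree terms vanish.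
   Context: A spherical $\Lambda$-code is a finite subset of the unit sphere $S^{n-1}\subset\mathbb R^n$ whose distinct points have inner products in $\Lambda$. Put $A_R=[r_1\ \cdots\ r_m]\in\mathbb R^{n\times m}$, $G=G_R=A_R^TA_R$, and $\Delta=\Lambda\cup\{1\}$; $e_i$ is the $i$-th standard basis vector of $\mathbb R^m$. $M\succeq 0$ means positive semidefinite. Labels: $U_R^{\mathrm{gen}}=\{u\in\Lambda^m: 1-u^TG^{-1}u\ge0\}$ and $U_R=U_R^{\mathrm{gen}}\cup\{Ge_1,\dots,Ge_m\}$. For $m=0$, $U_R=U_R^{\mathrm{gen}}$ consists of the single empty label, and all products involving empty labels are $0$. Feasible triples: $\Omega_R=\{(t,u,v): t\in\Delta,\ u,v\in U_R,\ H_{u,v,t}\succeq0\}$, where $H_{u,v,t}=\begin{pmatrix} G & u & v \\ {u^T} & 1 & t \\ {v^T} & t & 1 \end{pmatrix}$. Full domain: $D_R=\{(x\cdot y,A_R^Tx,A_R^Ty):x,y\in S^{n-1}\}$. The class $\operatorname{PD}(S^{n-1},R)$ consists of the continuous functions $F:D_R\to\mathbb R$ with $F(t,u,v)=F(t,v,u)$ such that for every finite list $x_1,\dots,x_N\in S^{n-1}$ the matrix $\bigl(F(x_i\cdot x_j,A_R^Tx_i,A_R^Tx_j)\bigr)_{i,j=1}^N$ is positive semidefinite. Polynomials $P_l^{n,m}$: put $p=n-m\ge2$, $h_u=1-u^TG^{-1}u$, $h_v=1-v^TG^{-1}v$, $w=t-u^TG^{-1}v$. Then $P_0^{n,m}=1$,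 $P_1^{n,m}=w$, and for $l\ge2$ $$P_l^{n,m}=\frac{(2l+p-4)\,w\,P_{l-1}^{n,m}-(l-1)\,h_uh_v\,P_{l-2}^{n,m}}{l+p-3},$$ all evaluated at $(G;u,v,t)$. (When $h_u,h_v>0$ this equals $(h_uh_v)^{l/2}P_l^{p}(w/\sqrt{h_uh_v})$, with $P_l^p$ the Gegenbauer polynomial for $S^{p-1}$ normalized by $P_l^p(1)=1$.) *)

(* Defs.v *)
From HB Require Import structures.
From mathcomp Require Import all_boot all_order all_algebra.
From mathcomp Require Import finmap.
From mathcomp Require Import all_classical all_reals all_analysis.
(* The notations of mpoly clash with those of mathcomp-analysis. *)
From mathcomp Require Import -(notations) mpoly.

Set Implicit Arguments.
Unset Strict Implicit.
Unset Printing Implicit Defensive.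

Import Order.TTheory GRing.Theory Num.Theory.
Import numFieldNormedType.Exports.

Local Open Scope classical_set_scope.
Local Open Scope ring_scope.

Definition dot (R : realType) (n : nat) (x y : 'cV[R]_n) : R :=
  (x^T *m y) 0 0.

Definition sphere (R : realType) (n : nat) : set 'cV[R]_n :=
  [set x | dot x x = 1].
Arguments sphere : clear implicits.

(* A finite subset of R^n is given by a sequence listing its points. *)
Definition spherical_code (R : realType) (n : nat) (L : {fset R})
    (s : seq 'cV[R]_n) : Prop :=
  (forall x, x \in s -> sphere R n x) /\
  (forall x y, x \in s -> y \in s -> x != y -> dot x y \in L).

(* The matrix [r_1 ... r_m] whose columns are the points of the code. *)
Definition code_mx (R : realType) (n m : nat) (r : m.-tuple 'cV[R]_n) :
    'M[R]_(n, m) :=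
  \matrix_(i, j) tnth r j i 0.

Definition gram (R : realType) (n m : nat) (r : m.-tuple 'cV[R]_n) : 'M[R]_m :=
  (code_mx r)^T *m code_mx r.

(* Real symmetric positive semidefinite matrices, indexed by any finite type:
   ordinals for ordinary matrices, or a finite set of labels. *)
Definition psd (R : realType) (I : finType) (M : I -> I -> R) : Prop :=
  (forall i j, M i j = M j i) /\
  (forall c : I -> R, 0 <= \sum_i \sum_j c i * M i j * c j).

(* The bilinear form u^T G^-1 v; G is invertible whenever it is the Gram
   matrix of a linearly independent family. *)
Definition ginv (R : realType) (m : nat) (G : 'M[R]_m) (u v : 'cV[R]_m) : R :=
  (u^T *m invmx G *m v) 0 0.

Definition cube (R : realType) (m : nat) (L : {fset R}) : {fset 'cV[R]_m} :=
  [fset \col_i val (f i) | f : {ffun 'I_m -> L} in predT]%fset.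

Definition gen_labels (R : realType) (m : nat) (L : {fset R}) (G : 'M[R]_m) :
    {fset 'cV[R]_m} :=
  [fset u in cube m L | 0 <= 1 - ginv G u u]%fset.

(* [delta_mx i 0] is the standard basis column e_i. *)
Definition ref_labels (R : realType) (m : nat) (G : 'M[R]_m) :
    {fset 'cV[R]_m} :=
  [fset G *m delta_mx i 0 | i in 'I_m]%fset.

Definition labels (R : realType) (m : nat) (L : {fset R}) (G : 'M[R]_m) :
    {fset 'cV[R]_m} :=
  (gen_labels L G `|` ref_labels G)%fset.

Definition Hmx (R : realType) (m : nat) (G : 'M[R]_m) (u v : 'cV[R]_m) (t : R) :
    'M[R]_(m + (1 + 1)) :=
  block_mx G (row_mx u v)
           (col_mx u^T v^T) (block_mx 1%:M t%:M t%:M 1%:M).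

Definition Omega (R : realType) (m : nat) (L : {fset R}) (G : 'M[R]_m) :
    set (R * 'cV[R]_m * 'cV[R]_m) :=
  [set z | let: (t, u, v) := z in
     [/\ t \in (1 |` L)%fset, u \in labels L G, v \in labels L G
       & psd (fun i j => Hmx G u v t i j)]].

Definition triple (R : realType) (n m : nat) (A : 'M[R]_(n, m))
    (x y : 'cV[R]_n) : R * 'cV[R]_m * 'cV[R]_m :=
  (dot x y, A^T *m x, A^T *m y).

Definition Dom (R : realType) (n m : nat) (A : 'M[R]_(n, m)) :
    set (R * 'cV[R]_m * 'cV[R]_m) :=
  [set triple A x y | x in sphere R n & y in sphere R n].

(* The class PD(S^{n-1}, R). A function on [Dom A] is represented by a total
   function; every clause depends only on its restriction to [Dom A]. *)
Definition PD (R : realType) (n m : nat) (A : 'M[R]_(n, m))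
    (F : R * 'cV[R]_m * 'cV[R]_m -> R) : Prop :=
  [/\ {within Dom A, continuous F},
      forall t u v, Dom A (t, u, v) -> F (t, u, v) = F (t, v, u)
    & forall (N : nat) (x : 'I_N -> 'cV[R]_n), (forall i, sphere R n (x i)) ->
        psd (fun i j => F (triple A (x i) (x j)))].

(* The recursion with p = n - m, h = h_u h_v and index l = k.+2; all
   subtractions are taken in R, so nothing is truncated. *)
Fixpoint gegenbauer_rec (R : realType) (p h w : R) (l : nat) : R :=
  match l with
  | 0%N => 1
  | l1.+1 =>
    match l1 with
    | 0%N => w
    | k.+1 =>
      ((2 * l%:R + p - 4) * w * gegenbauer_rec p h w l1
        - (l%:R - 1) * h * gegenbauer_rec p h w k) / (l%:R + p - 3)
    end
  end.

Definition Pnm (R : realType) (n m l : nat) (G : 'M[R]_m) (u v : 'cV[R]_m)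
    (t : R) : R :=
  gegenbauer_rec (n%:R - m%:R)
    ((1 - ginv G u u) * (1 - ginv G v v)) (t - ginv G u v) l.

(* Real polynomials in t, u_1..u_m, v_1..v_m, in this order: variable 0 is t. *)
Notation tuv_poly R m := (mpoly.mpoly (1 + (m + m)) R).

Definition tuv_eval (R : realType) (m : nat) (F : tuv_poly R m)
    (z : R * 'cV[R]_m * 'cV[R]_m) : R :=
  let: (t, u, v) := z in
  mpoly.meval (row_mx t%:M (row_mx u^T v^T) 0) F.

Definition tdeg_le (R : realType) (m d : nat) (F : tuv_poly R m) : Prop :=
  forall mon : mpoly.multinom (1 + (m + m)), mon \in mpoly.msupp F -> (mon (lshift (m + m) ord0) <= d)%N.

Lemma in_gen_labels (R : realType) (m : nat) (L : {fset R}) (G : 'M[R]_m) u :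
  u \in gen_labels L G = [forall i, u i 0 \in L] && (0 <= 1 - ginv G u u).
Proof.
rewrite !inE /=; congr andb; apply/imfsetP/forallP => /= [[f _ ->] i|uL].
  by rewrite mxE; apply: valP.
exists [ffun i => [` uL i]%fset] => //.
by apply/matrixP => i j; rewrite mxE ffunE /= (ord1 j).
Qed.

Lemma in_ref_labels (R : realType) (m : nat) (G : 'M[R]_m) u :
  u \in ref_labels G = [exists i, u == G *m delta_mx i 0].
Proof.
apply/imfsetP/existsP => /= [[i _ ->]|[i /eqP ->]]; first by exists i.
by exists i.
Qed.

(* Main.v *)
Require Import Defs.
From mathcomp Require Import all_boot all_order all_algebra ring lra.
From mathcomp Require Import finmap.
From mathcomp Require Import all_classical all_reals all_analysis.
From mathcomp Require Import -(notations) mpoly.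

Set Implicit Arguments.
Unset Strict Implicit.
Unset Printing Implicit Defensive.

Import Order.TTheory GRing.Theory Num.Theory.
Import numFieldNormedType.Exports.

Local Open Scope classical_set_scope.
Local Open Scope ring_scope.

(* Writing x = A G^-1 u + x' with u = A^T x and x' orthogonal to the code, the
   kernel P_l^{n,m} at (x.y, A^T x, A^T y) becomes the solid zonal harmonic of
   degree l of the p-dimensional space W = im P, P = 1 - A G^-1 A^T, at
   (x', y').  In the Fischer inner product [f, g |-> (f(d) g)(0)], where
   multiplication by a linear form is adjoint to a derivative, the zonal harmonics
   Z_y satisfy <Z_x, Z_y> = c * Z_y(x) with c > 0, because Z_x is killed by the
   Laplacian and Z_y is a multiple of the l-th power of the linear form y modulo
   |.|^2; hence they are positive definite kernels, and a Schur product with the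
   Lagrange interpolation of the matrices M_l gives (ii) => (i).
   For (i) => (ii), expand F in the P_l^{n,m}, which have degree l in t.
   Integration over the sphere is replaced by linear algebra: harmonics of
   different degrees are linearly independent on the unit sphere of W, so for
   each l <= d there are finitely many points x_a of that sphere and weights c_a
   with sum_(a, b) c_a c_b Z_j(x_a, x_b) = [j = l] for all j <= d. Testing the
   positivity of F on the points above each label u given by the x_a extracts the
   l-th coefficient as a positive semidefinite matrix. *)

Lemma nat_ind2 (Q : nat -> Prop) :
  Q 0%N -> Q 1%N -> (forall k, Q k -> Q k.+1 -> Q k.+2) -> forall l, Q l.
Proof.
move=> Q0 Q1 QS l; suff [] : Q l /\ Q l.+1 by [].
by elim: l => [//|l [IH0 IH1]]; split=> //; apply: QS.
Qed.

(** * Multivariate polynomials that vanish at every point *)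

Section MpolyVanishing.
Variables (R : numDomainType) (n : nat).
Implicit Types (f g : mpoly n R) (m : multinom n) (v : 'I_n -> R).

Let line v (i j : 'I_n) : {poly R} := (v j)%:P + (j == i)%:R *: 'X.

Lemma horner_line v i f t :
  (mmap polyC (line v i) f).[t] = meval (fun j => v j + (j == i)%:R * t) f.
Proof.
rewrite mevalE /mmap horner_sum; apply: eq_bigr => m _.
rewrite hornerM hornerC; congr (_ * _).
rewrite /mmap1 horner_prod; apply: eq_bigr => j _.
by rewrite horner_exp /line !hornerE.
Qed.

Lemma deriv_line v i f :
  (mmap polyC (line v i) f)^`() = mmap polyC (line v i) (mderiv i f).
Proof.
elim/mpolyind: f => [|c m f _ _ IH]; first by rewrite mderiv0 !mmap0 deriv0.
rewrite mderivD !mmapD derivD IH; congr (_ + _); rewrite mderivZ.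
rewrite !mmapZ mderivX mmapZ !mmapX derivM derivC mul0r add0r.
congr (_ * _); rewrite /mmap1 (bigD1 i) //= [in RHS](bigD1 i) //= derivM.
have -> : (\prod_(j | j != i) line v i j ^+ m j)^`() = 0.
  rewrite (eq_bigr (fun j => (v j ^+ m j)%:P)); last first.
    by move=> j /negPf ji; rewrite /line ji scale0r addr0 rmorphXn.
  by rewrite -rmorph_prod derivC.
rewrite mulr0 addr0 deriv_exp /line eqxx scale1r derivD derivC derivX add0r mul1r.
rewrite mnmBE mnm1E eqxx subn1 -mulr_natl -mulrA polyCMn polyC1; congr (_ * (_ * _)).
by apply: eq_bigr => j ji; rewrite mnmBE mnm1E [i == j]eq_sym (negPf ji) subn0.
Qed.

(** Restricted to a line parallel to the axis [i], [f] is a univariate polynomial having all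
    naturals as roots. It is therefore zero, and so is its derivative. *)
Lemma meval_deriv_eq0 f i : (forall v, meval v f = 0) ->
  forall v, meval v (mderiv i f) = 0.
Proof.
move=> f0 v.
have P0 : mmap polyC (line v i) f = 0.
  apply/eqP; apply/negPn/negP => nz.
  pose s := [seq k%:R | k <- iota 0 (size (mmap polyC (line v i) f))] : seq R.
  have := @max_poly_roots _ _ s nz; rewrite size_map size_iota ltnn.
  case/(_ _ _)/implyP => //.
    by apply/allP => t _; rewrite rootE horner_line f0.
  by rewrite map_inj_uniq ?iota_uniq // => a b /eqP; rewrite eqr_nat => /eqP.
have := congr1 (fun p : {poly R} => p^`().[0]) P0; rewrite /= deriv_line horner_line.
rewrite deriv0 horner0; congr (_ = _); apply: meval_eq => j.
by rewrite mulr0 addr0.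
Qed.

Lemma mcoeff0_meval f : mcoeff mnm0 f = meval (fun=> 0) f.
Proof.
elim/mpolyind: f => [|c m f _ _ IH]; first by rewrite mcoeff0 meval0.
rewrite mcoeffD mevalD IH; congr (_ + _).
rewrite mcoeffZ mevalZ mcoeffX mevalX; congr (_ * _).
case: eqVneq => [->|m0].
  by rewrite big1 // => i _; rewrite mnm0E.
have [i mi] : exists i, m i != 0%N.
  apply/existsP; rewrite -negb_forall; apply: contra m0 => /forallP m0.
  by apply/eqP/mnmP => i; rewrite mnm0E; apply/eqP.
by rewrite (bigD1 i) //= expr0n (negPf mi) mul0r.
Qed.

(** Iterating [meval_deriv_eq0], all derivatives of [f] vanish at 0, where they are the coefficients
    of [f] times products of factorials, nonzero in characteristic 0. *)
Lemma meval_eq0 f : (forall v, meval v f = 0) -> f = 0.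
Proof.
move=> f0.
have D k : forall g, (forall v, meval v g = 0) ->
    forall m, mdeg m = k -> forall v, meval v (mderivm m g) = 0.
  elim: k => [|k IH] g g0 m.
    by move/eqP; rewrite mdeg_eq0 => /eqP -> v; rewrite mderivm0m.
  move=> mk v.
  have [i mi] : exists i, m i != 0%N.
    apply/existsP; rewrite -negb_forall; apply/negP => /forallP m0.
    by move: mk; rewrite mdegE big1 // => i _; apply/eqP.
  have Em : m = mnm_add (mnm1 i) (mnm_sub m (mnm1 i)).
    by rewrite addmC submK // lep1mP.
  rewrite Em mderivmDm mderivmU1m; apply: IH; first exact: meval_deriv_eq0.
  by move: mk; rewrite {1}Em mdegD mdeg1 add1n => -[].
apply/mpolyP => m; rewrite mcoeff0.
have := mcoeff_mderivm m f mnm0; rewrite mcoeff0_meval (D (mdeg m)) //.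
rewrite addm0 => /esym/eqP; rewrite mulrn_eq0 => /orP[|/eqP //].
rewrite -[_ == 0%N]negbK -lt0n prodn_cond_gt0 // => i _.
by rewrite ffact_gt0.
Qed.
End MpolyVanishing.

(** * The Fischer inner product *)

Section Fischer.
Variables (R : realFieldType) (n : nat).
Implicit Types (f g h : mpoly n R) (m : multinom n) (c : R).

Definition mfactorial m : R := (\prod_(i < n) (m i)`!)%:R.

Lemma mfactorial_gt0 m : 0 < mfactorial m.
Proof. by rewrite ltr0n prodn_cond_gt0 // => i _; apply: fact_gt0. Qed.

(* The apolar (Fischer) inner product [f, g |-> (f(d) g)(0)]. *)
Definition fischer f g : R :=
  \sum_(m <- msupp f) mfactorial m * mcoeff m f * mcoeff m g.

(** Summing over all monomials of bounded degree instead of the support of [f] makes the symmetry of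
    the form visible. *)
Lemma fischerE k f g : (msize f <= k)%N ->
  fischer f g = \sum_(m : bmultinom n k) mfactorial m * mcoeff m f * mcoeff m g.
Proof.
move=> fk; pose I : subFinType _ := bmultinom n k.
rewrite /fischer (ssrcomplements.big_mksub I) /=; last first.
- by move=> x /msize_mdeg_lt /leq_trans; apply.
- by rewrite msupp_uniq.
rewrite bigop.big_rmcond //= => m; move/memN_msupp_eq0 => ->; by rewrite mulr0 mul0r.
Qed.

Lemma fischerC f g : fischer f g = fischer g f.
Proof.
pose k := maxn (msize f) (msize g).
rewrite (@fischerE k) ?leq_maxl // (@fischerE k) ?leq_maxr //.
by apply: eq_bigr => m _; rewrite -!mulrA [mcoeff _ _ * _]mulrC.
Qed.

Lemma fischerDr f g h : fischer f (g + h) = fischer f g + fischer f h.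
Proof. by rewrite -big_split; apply: eq_bigr => m _; rewrite mcoeffD mulrDr. Qed.

Lemma fischerZr f c g : fischer f (c *: g) = c * fischer f g.
Proof.
by rewrite mulr_sumr; apply: eq_bigr => m _; rewrite mcoeffZ mulrCA.
Qed.

Lemma fischer0r f : fischer f 0 = 0.
Proof. by rewrite -[0 in LHS](scale0r 0) fischerZr mul0r. Qed.

Lemma fischer_sumr (I : Type) (s : seq I) (P : pred I) f (g : I -> mpoly n R) :
  fischer f (\sum_(i <- s | P i) g i) = \sum_(i <- s | P i) fischer f (g i).
Proof.
by apply: (big_morph (fischer f)); [apply: fischerDr|apply: fischer0r].
Qed.

Lemma fischerDl f g h : fischer (g + h) f = fischer g f + fischer h f.
Proof. by rewrite !(fischerC _ f) fischerDr. Qed.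

Lemma fischerZl f c g : fischer (c *: g) f = c * fischer g f.
Proof. by rewrite !(fischerC _ f) fischerZr. Qed.

Lemma fischerBl f g h : fischer (g - h) f = fischer g f - fischer h f.
Proof. by rewrite -scaleN1r fischerDl fischerZl mulN1r. Qed.

Lemma fischer_suml (I : Type) (s : seq I) (P : pred I) f (g : I -> mpoly n R) :
  fischer (\sum_(i <- s | P i) g i) f = \sum_(i <- s | P i) fischer (g i) f.
Proof. by rewrite fischerC fischer_sumr; apply: eq_bigr => i _; apply: fischerC. Qed.

Lemma fischer11 : fischer 1 1 = 1.
Proof.
rewrite /fischer msupp1 big_seq1 mcoeff1 eqxx !mulr1 /mfactorial big1 //.
by move=> i _; rewrite mnm0E.
Qed.

Lemma fischer_term_ge0 f m : 0 <= mfactorial m * mcoeff m f * mcoeff m f.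
Proof.
by rewrite -mulrA mulr_ge0 ?(ltW (mfactorial_gt0 _)) // -expr2 sqr_ge0.
Qed.

Lemma fischer_ge0 f : 0 <= fischer f f.
Proof. by apply: sumr_ge0 => m _; apply: fischer_term_ge0. Qed.

Lemma fischer_eq0 f : fischer f f = 0 -> f = 0.
Proof.
move=> f0; apply/mpolyP => m; rewrite mcoeff0.
case: (boolP (m \in msupp f)) => [mf|/memN_msupp_eq0 //].
move/eqP: f0; rewrite /fischer psumr_eq0; last by move=> k _; apply: fischer_term_ge0.
move/allP/(_ m mf); rewrite /= -mulrA mulf_eq0 (gt_eqF (mfactorial_gt0 _)) /=.
by rewrite mulf_eq0 orbb => /eqP.
Qed.

(** For a monomial [f] of exponent $m$ this is $(m+e_i)! = (m_i+1)\,m!$, the factor $m_i+1$ coming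
    from the differentiation. *)
Lemma fischer_mulX f g i : fischer (mpolyX R (mnm1 i) * f) g = fischer f (mderiv i g).
Proof.
rewrite [f]mpolyE mulr_sumr !fischer_suml; apply: eq_bigr => m _.
rewrite -scalerAr !fischerZl -mpolyXD; congr (_ * _).
rewrite /fischer !msuppX !big_seq1 !mcoeffX !eqxx !mulr1 mcoeff_deriv addmC.
rewrite -mulr_natl mulrA; congr (_ * _).
rewrite /mfactorial -natrM; congr (_%:R).
rewrite (bigD1 i) //= [in RHS](bigD1 i) //= mnmDE mnm1E eqxx addn1 factS.
rewrite [(_ * _ * _.+1)%N]mulnAC [(_`! * _)%N]mulnC; congr (_ * _)%N.
by apply: eq_bigr => j ji; rewrite mnmDE mnm1E eq_sym (negPf ji) addn0.
Qed.
End Fischer.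

(** * Finite spanning subfamilies *)

Section FiniteSpan.
Variables (F : fieldType) (N : nat) (T : Type) (S : T -> Prop) (z : T -> 'rV[F]_N).

(** Otherwise a vector outside the current span could be added again and again, and the rank would
    exceed [N]. *)
Lemma finite_span : exists k (t : 'I_k -> T), (forall i, S (t i)) /\
  forall x, S x -> exists b : 'I_k -> F, z x = \sum_i b i *: z (t i).
Proof.
pose M k (t : 'I_k -> T) := \matrix_i z (t i).
pose spans k (t : 'I_k -> T) := forall x, S x -> (z x <= M k t)%MS.
suff [k [t [tS tspan]]] : exists k (t : 'I_k -> T), (forall i, S (t i)) /\ spans k t.
  exists k, t; split=> // x /tspan/submxP[b ->]; exists (b 0).
  by rewrite mulmx_sum_row; apply: eq_bigr => i _; rewrite rowK.
apply: contrapT => no_span.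
have grow r : exists k (t : 'I_k -> T), (forall i, S (t i)) /\ (r <= \rank (M k t))%N.
  elim: r => [|r [k [t [tS tr]]]].
    have t0 : 'I_0 -> T by case.
    by exists 0%N, t0; split=> // -[].
  have [x /not_implyP[xS xt]] : exists x, ~ (S x -> (z x <= M k t)%MS).
    by apply/existsNP => tspan; apply: no_span; exists k, t.
  pose t' (i : 'I_k.+1) := oapp t x (unlift ord0 i).
  exists k.+1, t'; split=> [i|]; first by rewrite /t'; case: unliftP => [j|] _ /=.
  have tt' : (M k t <= M k.+1 t')%MS.
    apply/row_subP => i; rewrite rowK.
    have -> : z (t i) = row (lift ord0 i) (M k.+1 t') by rewrite rowK /t' liftK.
    exact: row_sub.
  have xt' : (z x <= M k.+1 t')%MS.
    have -> : z x = row ord0 (M k.+1 t') by rewrite rowK /t' unlift_none.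
    exact: row_sub.
  apply: leq_ltn_trans tr _; rewrite ltn_neqAle mxrankS // andbT.
  apply: contra_notN xt => /eqP rk.
  by apply: submx_trans xt' _; rewrite -(geq_leqif (mxrank_leqif_sup tt')) rk.
have [k [t [_ tr]]] := grow N.+1.
by have := leq_trans tr (rank_leq_col _); rewrite ltnn.
Qed.
End FiniteSpan.

(** * The dot product *)

Section Dot.
Variables (R : realType) (n : nat).
Implicit Types (x y z : 'cV[R]_n) (c : R).

Lemma dotE x y : dot x y = \sum_i x i 0 * y i 0.
Proof. by rewrite /dot mxE; apply: eq_bigr => i _; rewrite mxE. Qed.

Lemma dotC x y : dot x y = dot y x.
Proof. by rewrite !dotE; apply: eq_bigr => i _; rewrite mulrC. Qed.

Lemma dotDl x y z : dot (x + y) z = dot x z + dot y z.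
Proof. by rewrite /dot linearD mulmxDl mxE. Qed.

Lemma dotDr x y z : dot x (y + z) = dot x y + dot x z.
Proof. by rewrite !(dotC x) dotDl. Qed.

Lemma dotZl c x y : dot (c *: x) y = c * dot x y.
Proof. by rewrite /dot linearZ -scalemxAl mxE. Qed.

Lemma dotZr c x y : dot x (c *: y) = c * dot x y.
Proof. by rewrite !(dotC x) dotZl. Qed.

Lemma dot_mulmxl (k : nat) (A : 'M[R]_(n, k)) (u : 'cV[R]_k) x :
  dot (A *m u) x = dot u (A^T *m x).
Proof. by rewrite /dot trmx_mul mulmxA. Qed.

Lemma dot_ge0 x : 0 <= dot x x.
Proof. by rewrite dotE sumr_ge0 // => i _; rewrite -expr2 sqr_ge0. Qed.

Lemma dot_eq0 x : (dot x x == 0) = (x == 0).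
Proof.
apply/idP/eqP => [|->]; last by rewrite dotE big1 // => i _; rewrite mxE mul0r.
rewrite dotE psumr_eq0 => [/allP x0|i _]; last by rewrite -expr2 sqr_ge0.
apply/matrixP => i j; rewrite (ord1 j) mxE; apply/eqP.
by have := x0 i (mem_index_enum i); rewrite /= mulf_eq0 orbb.
Qed.
End Dot.

(** * Linear forms and directional derivatives *)

Section Directional.
Variables (R : realType) (n : nat).
Implicit Types (u v : 'cV[R]_n) (f g : mpoly n R) (c : R).

Definition linform v : mpoly n R := \sum_j v j 0 *: mpolyX R (mnm1 j).

Definition dirderiv v f : mpoly n R := \sum_j v j 0 *: mderiv j f.

Lemma linform_sum (I : finType) (c : I -> R) (v : I -> 'cV[R]_n) :
  \sum_i c i *: linform (v i) = linform (\sum_i c i *: v i).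
Proof.
rewrite /linform (eq_bigr _ (fun i _ => scaler_sumr _ _ _ _)) exchange_big /=.
apply: eq_bigr => j _; rewrite summxE scaler_suml; apply: eq_bigr => i _.
by rewrite scalerA mxE.
Qed.

Lemma dirderiv_sum (I : finType) (c : I -> R) (v : I -> 'cV[R]_n) f :
  \sum_i c i *: dirderiv (v i) f = dirderiv (\sum_i c i *: v i) f.
Proof.
rewrite /dirderiv (eq_bigr _ (fun i _ => scaler_sumr _ _ _ _)) exchange_big /=.
apply: eq_bigr => j _; rewrite summxE scaler_suml; apply: eq_bigr => i _.
by rewrite scalerA mxE.
Qed.

Lemma dirderivD v f g : dirderiv v (f + g) = dirderiv v f + dirderiv v g.
Proof.
by rewrite -big_split; apply: eq_bigr => j _; rewrite mderivD scalerDr.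
Qed.

Lemma dirderivZ v c f : dirderiv v (c *: f) = c *: dirderiv v f.
Proof.
rewrite scaler_sumr; apply: eq_bigr => j _.
by rewrite mderivZ scalerA mulrC -scalerA.
Qed.

Lemma dirderivB v f g : dirderiv v (f - g) = dirderiv v f - dirderiv v g.
Proof. by rewrite -scaleN1r dirderivD dirderivZ scaleN1r. Qed.

Lemma dirderiv0 v : dirderiv v 0 = 0.
Proof. by have := dirderivZ v 0 0; rewrite !scale0r. Qed.

Lemma dirderiv_big (I : Type) (s : seq I) (P : pred I) v (f : I -> mpoly n R) :
  dirderiv v (\sum_(i <- s | P i) f i) = \sum_(i <- s | P i) dirderiv v (f i).
Proof.
by apply: (big_morph (dirderiv v)); [apply: dirderivD|apply: dirderiv0].
Qed.

Lemma dirderivM v f g : dirderiv v (f * g) = dirderiv v f * g + f * dirderiv v g.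
Proof.
rewrite /dirderiv mulr_suml mulr_sumr -big_split; apply: eq_bigr => j _ /=.
by rewrite mderivM scalerDr scalerAl scalerAr.
Qed.

Lemma dirderivC v c : dirderiv v (c *: 1) = 0.
Proof.
rewrite dirderivZ /dirderiv big1 ?scaler0 // => j _.
by rewrite -mpolyC1 mderivC scaler0.
Qed.

Lemma dirderiv_linform v u : dirderiv v (linform u) = dot v u *: 1.
Proof.
rewrite dotE scaler_suml /dirderiv; apply: eq_bigr => j _; rewrite -scalerA.
congr (_ *: _); rewrite /linform linear_sum (bigD1 j) //= big1 => [|i ij].
  rewrite addr0 mderivZ mderivX mnm1E eqxx scale1r.
  rewrite (_ : mnm_sub _ _ = mnm0) ?mpolyX0 //; apply/mnmP => i.
  by rewrite mnmBE subnn mnm0E.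
by rewrite mderivZ mderivX mnm1E (negPf ij) scale0r scaler0.
Qed.

Lemma fischer_linform v f g : fischer (linform v * f) g = fischer f (dirderiv v g).
Proof.
rewrite mulr_suml fischer_suml fischer_sumr; apply: eq_bigr => j _.
by rewrite -scalerAl fischerZl fischerZr fischer_mulX.
Qed.

Lemma meval_linform (x v : 'cV[R]_n) : meval (fun i => x i 0) (linform v) = dot x v.
Proof.
rewrite /linform linear_sum dotE; apply: eq_bigr => j _.
by rewrite /= mevalZ mevalXU mulrC.
Qed.
End Directional.

(** * Zonal harmonics on the image of a projection *)

Section Zonal.
Variables (R : realType) (n : nat) (P : 'M[R]_n).
Hypotheses (P_sym : P^T = P) (P_idem : P *m P = P) (trP_gt1 : 1 < \tr P).
Implicit Types (x y : 'cV[R]_n) (f g : mpoly n R) (c : R) (l : nat).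

(** [p] is the dimension of W = im P, since [P] is an orthogonal projection. The columns of [P] form
    a Parseval frame of W, which replaces an orthonormal basis below: [sqform] is $|PX|^2$ and [lap]
    is the Laplacian of W. *)
Let p := \tr P.
Let L i := linform (col i P).
Let D i := dirderiv (col i P).

Definition sqform : mpoly n R := \sum_i L i ^+ 2.

Definition lap f : mpoly n R := \sum_i D i (D i f).

Lemma dot_projl x y : dot (P *m x) y = dot x (P *m y).
Proof. by rewrite dot_mulmxl P_sym. Qed.

Lemma dot_proj x y : dot (P *m x) (P *m y) = dot x (P *m y).
Proof. by rewrite dot_projl mulmxA P_idem. Qed.

Lemma dot_col i x : dot (col i P) x = (P *m x) i 0.
Proof. by rewrite dotE mxE; apply: eq_bigr => j _; rewrite -[in RHS]P_sym !mxE. Qed.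

Lemma sum_col x : \sum_i x i 0 *: col i P = P *m x.
Proof.
apply/matrixP => i j; rewrite (ord1 j) summxE mxE; apply: eq_bigr => k _.
by rewrite !mxE mulrC.
Qed.

Lemma proj_col i : P *m col i P = col i P.
Proof. by rewrite -{3}P_idem !colE mulmxA. Qed.

Lemma dirderiv_sqform v : dirderiv v sqform = 2 *: linform (P *m v).
Proof.
rewrite /sqform dirderiv_big -[P in RHS]P_idem -mulmxA -sum_col -linform_sum.
rewrite scaler_sumr; apply: eq_bigr => i _.
rewrite expr2 dirderivM !dirderiv_linform dotC dot_col.
by rewrite -scalerAl mul1r -scalerAr mulr1 scaler_nat mulr2n.
Qed.

Definition euler f : mpoly n R := \sum_i L i * D i f.

Lemma lapM f g :
  lap (f * g) = lap f * g + f * lap g + 2 *: \sum_i D i f * D i g.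
Proof.
rewrite /lap mulr_suml mulr_sumr scaler_sumr -!big_split; apply: eq_bigr => i _.
by rewrite /= /D !(dirderivM, dirderivD) scaler_nat mulr2n; ring.
Qed.

Lemma lapZ c f : lap (c *: f) = c *: lap f.
Proof. by rewrite scaler_sumr; apply: eq_bigr => i _; rewrite /D !dirderivZ. Qed.

Lemma lapB f g : lap (f - g) = lap f - lap g.
Proof. by rewrite -sumrB; apply: eq_bigr => i _; rewrite /D !dirderivB. Qed.

Lemma fischer_sqform f g : fischer (sqform * f) g = fischer f (lap g).
Proof.
rewrite /sqform mulr_suml fischer_suml fischer_sumr; apply: eq_bigr => i _.
by rewrite expr2 -mulrA !fischer_linform.
Qed.

Lemma eulerM f g : euler (f * g) = euler f * g + f * euler g.
Proof.
rewrite mulr_suml mulr_sumr -big_split; apply: eq_bigr => i _.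
by rewrite /= /D dirderivM; ring.
Qed.

Lemma eulerZ c f : euler (c *: f) = c *: euler f.
Proof.
by rewrite scaler_sumr; apply: eq_bigr => i _; rewrite /D dirderivZ scalerAr.
Qed.

Lemma eulerB f g : euler (f - g) = euler f - euler g.
Proof. by rewrite -sumrB; apply: eq_bigr => i _; rewrite /D dirderivB mulrBr. Qed.

Lemma euler_sqform : euler sqform = 2 *: sqform.
Proof.
rewrite scaler_sumr; apply: eq_bigr => i _.
by rewrite /D dirderiv_sqform -scalerAr proj_col.
Qed.

Lemma lap_sqform : lap sqform = (2 * p) *: 1.
Proof.
rewrite -scalerA /p /mxtrace scaler_suml scaler_sumr; apply: eq_bigr => i _.
rewrite /D dirderiv_sqform dirderivZ dirderiv_linform proj_col dot_col proj_col.
by rewrite mxE.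
Qed.

Lemma lap_sqM f : lap (sqform * f) = sqform * lap f + (2 * p) *: f + 4 *: euler f.
Proof.
rewrite lapM lap_sqform -scalerAl mul1r [_ *: f + _]addrC; congr (_ + _).
rewrite !scaler_sumr; apply: eq_bigr => i _.
by rewrite /D dirderiv_sqform proj_col -scalerAl scalerA -natrM.
Qed.

Definition zlin y : mpoly n R := linform (P *m y).

Lemma dirderiv_zlin x y : dirderiv (P *m x) (zlin y) = dot x (P *m y) *: 1.
Proof. by rewrite dirderiv_linform dot_proj. Qed.

Lemma dirderiv_col_zlin i y : D i (zlin y) = (P *m y) i 0 *: 1.
Proof. by rewrite /D dirderiv_linform dot_col mulmxA P_idem. Qed.

Lemma lap_zlinM y f : lap (zlin y * f) = zlin y * lap f + 2 *: dirderiv (P *m y) f.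
Proof.
rewrite lapM {1}/lap (eq_bigr (fun=> 0)) => [|i _]; last first.
  by rewrite dirderiv_col_zlin /D dirderivC.
rewrite big1_eq mul0r add0r; congr (_ + _ *: _).
rewrite -[P in RHS]P_idem -mulmxA -sum_col -dirderiv_sum; apply: eq_bigr => i _.
by rewrite dirderiv_col_zlin -scalerAl mul1r.
Qed.

Lemma euler_zlin y : euler (zlin y) = zlin y.
Proof.
rewrite /euler (eq_bigr _ (fun i _ => congr1 _ (dirderiv_col_zlin i y))) /zlin.
rewrite -[P in RHS]P_idem -mulmxA -[in RHS]sum_col -linform_sum.
by apply: eq_bigr => i _; rewrite -scalerAr mulr1.
Qed.

Definition bform x y := dot x (P *m y).

Lemma bformC x y : bform x y = bform y x.
Proof. by rewrite /bform -dot_projl dotC. Qed.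

(* The recursion of [P_l^{n,m}] with [h = |P y|^2 |P X|^2] and [w = (P y).X], as a
   polynomial in [X = (X_1, ..., X_n)]. *)
Fixpoint zpoly y l : mpoly n R :=
  match l with
  | 0%N => 1
  | l1.+1 =>
    match l1 with
    | 0%N => zlin y
    | k.+1 => (l%:R + p - 3)^-1 *:
       ((2 * l%:R + p - 4) *: (zlin y * zpoly y l1)
        - ((l%:R - 1) * bform y y) *: (sqform * zpoly y k))
    end
  end.

Lemma gegen_den_gt0 k : 0 < k.+2%:R + p - 3.
Proof. by rewrite -addn2 natrD; have := ler0n R k; move: trP_gt1; rewrite -/p; lra. Qed.

Lemma zpolySS y k : (k.+2%:R + p - 3) *: zpoly y k.+2 =
  (2 * k.+2%:R + p - 4) *: (zlin y * zpoly y k.+1)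
    - ((k.+2%:R - 1) * bform y y) *: (sqform * zpoly y k).
Proof. by rewrite [zpoly y k.+2]/= scalerA divff ?scale1r // gt_eqF // gegen_den_gt0. Qed.

Lemma scaler_inj c f g : 0 < c -> c *: f = c *: g -> f = g.
Proof. by move=> c0; apply: scalerI; rewrite gt_eqF. Qed.

(** The Laplacian of [zlin y * zpoly y k.+1] produces this derivative. The induction carries two
    consecutive degrees because the recursion has two terms. *)
Lemma dirderiv_zpoly y k :
  dirderiv (P *m y) (zpoly y k.+1) = (k.+1%:R * bform y y) *: zpoly y k.
Proof.
set b := bform y y.
have D1 : dirderiv (P *m y) (zlin y) = b *: 1 by apply: dirderiv_zlin.
have Ds : dirderiv (P *m y) sqform = 2 *: zlin y.
  by rewrite dirderiv_sqform mulmxA P_idem.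
suff [//] : dirderiv (P *m y) (zpoly y k.+1) = (k.+1%:R * b) *: zpoly y k /\
   dirderiv (P *m y) (zpoly y k.+2) = (k.+2%:R * b) *: zpoly y k.+1.
elim: k => [|k [IH0 IH1]]; split.
- by rewrite mul1r.
- apply: (scaler_inj (gegen_den_gt0 0)).
  rewrite -dirderivZ zpolySS dirderivB !dirderivZ !dirderivM Ds /= D1 -/b.
rewrite -mpolyC1 /dirderiv (eq_bigr (fun=> 0)) => [|i _]; last first.
    by rewrite mderivC scaler0.
  rewrite big1_eq -!mul_mpolyC; ring.
- by [].
apply: (scaler_inj (gegen_den_gt0 k.+1)).
rewrite -dirderivZ zpolySS dirderivB !dirderivZ !dirderivM Ds D1 IH1 IH0 -/b.
have /eqP := zpolySS y k; rewrite -/b -subr_eq0.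
move: (zpoly y k.+2) (zpoly y k.+1) (zpoly y k) => z2 z1 z0 /eqP rec.
(* The two sides differ by [- (k.+2%:R * b)] times the recursion one degree lower. *)
apply: subr0_eq; rewrite -[RHS](scaler0 _ (- (k.+2%:R * b))) -rec.
by rewrite -!mul_mpolyC; ring.
Qed.

Lemma dirderiv1 (v : 'cV[R]_n) : dirderiv v 1 = 0.
Proof. by rewrite -[1]scale1r dirderivC. Qed.

Lemma dirderivX v f k : dirderiv v (f ^+ k.+1) = k.+1%:R *: (f ^+ k * dirderiv v f).
Proof.
elim: k => [|k IH]; first by rewrite expr1 expr0 mul1r scale1r.
by rewrite exprS dirderivM IH -!mul_mpolyC exprS; ring.
Qed.

Lemma lap1 : lap 1 = 0.
Proof. by rewrite /lap big1 // => i _; rewrite /D dirderiv1 dirderiv0. Qed.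

Lemma euler1 : euler 1 = 0.
Proof. by rewrite /euler big1 // => i _; rewrite /D dirderiv1 mulr0. Qed.

Lemma lap_zlin y : lap (zlin y) = 0.
Proof.
by have := lap_zlinM y 1; rewrite lap1 dirderiv1 mulr0 scaler0 addr0 mulr1.
Qed.

Lemma lap_zlinX y k : lap (zlin y ^+ k.+2) =
  (k.+2%:R * k.+1%:R * bform y y) *: zlin y ^+ k.
Proof.
elim: k => [|k IH]; rewrite exprS lap_zlinM ?IH dirderivX dirderiv_zlin.
  rewrite expr1 lap_zlin -!mul_mpolyC /bform. ring.
by rewrite -!mul_mpolyC /bform !exprS; ring.
Qed.

Lemma euler_zpoly y l : euler (zpoly y l) = l%:R *: zpoly y l.
Proof.
elim/nat_ind2: l => [||k IH0 IH1]; first by rewrite euler1 scale0r.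
  by rewrite scale1r; apply: euler_zlin.
apply: (scaler_inj (gegen_den_gt0 k)); rewrite [RHS]scalerA mulrC -scalerA.
rewrite -eulerZ zpolySS eulerB !eulerZ !eulerM IH0 IH1 euler_zlin euler_sqform.
by rewrite -!mul_mpolyC; ring.
Qed.

(** In degree $l$ the first term of the recursion contributes $2(2l+p-4)(l-1)|Py|^2 Z_{l-2}$ by
    [dirderiv_zpoly], and the second, by [euler_zpoly], $(l-1)|Py|^2(2p+4(l-2))Z_{l-2}$; these
    cancel. *)
Lemma lap_zpoly y l : lap (zpoly y l) = 0.
Proof.
elim/nat_ind2: l => [||k IH0 IH1]; [exact: lap1|exact: lap_zlin|].
apply: (scaler_inj (gegen_den_gt0 k)); rewrite scaler0.
rewrite -lapZ zpolySS lapB !lapZ lap_zlinM lap_sqM IH0 IH1 dirderiv_zpoly euler_zpoly.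
by rewrite -!mul_mpolyC; ring.
Qed.

Definition zonal l x y := gegenbauer_rec p (bform x x * bform y y) (bform x y) l.

Lemma gegenbauer_recSS h w k : (k.+2%:R + p - 3) * gegenbauer_rec p h w k.+2 =
  (2 * k.+2%:R + p - 4) * w * gegenbauer_rec p h w k.+1
    - (k.+2%:R - 1) * h * gegenbauer_rec p h w k.
Proof.
rewrite [gegenbauer_rec p h w k.+2]/= mulrC divfK //.
by rewrite gt_eqF // gegen_den_gt0.
Qed.

(** Pairing with the $l$-th power of the linear form of $y$ is evaluation at $y$ up to $l!$. Here it
    follows from the recursion, [zlin x] and [sqform] passing to the other side as a derivative and
    the Laplacian. *)
Lemma fischer_zpoly_zlin x y l :
  fischer (zpoly x l) (zlin y ^+ l) = l`!%:R * zonal l x y.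
Proof.
elim/nat_ind2: l => [||k IH0 IH1]; first by rewrite expr0 fischer11 mul1r.
  rewrite expr1 mul1r /zonal /= -[zlin x]mulr1 fischer_linform dirderiv_zlin.
  by rewrite fischerZr fischer11 mulr1.
have d0 := lt0r_neq0 (gegen_den_gt0 k).
apply: (mulfI d0); rewrite -fischerZl zpolySS fischerBl !fischerZl.
rewrite fischer_linform fischer_sqform dirderivX dirderiv_zlin lap_zlinX.
rewrite -scalerAr mulr1 !fischerZr IH0 IH1 [RHS]mulrCA gegenbauer_recSS !factS !natrM.
by rewrite /zonal /bform; ring.
Qed.

(** Modulo [sqform] the recursion multiplies by [zlin y] and by the positive constant
    $(2l+p-4)/(l+p-3)$. Hence [a] is the same for all [y], as a common factor of the kernel must
    be. *)
Lemma zpoly_lead l : exists2 a : R, 0 < a &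
  forall y, exists q, zpoly y l = a *: zlin y ^+ l + sqform * q.
Proof.
elim/nat_ind2: l => [||k _ [a a0 Ea]].
- by exists 1 => // y; exists 0; rewrite mulr0 addr0 scale1r.
- by exists 1 => // y; exists 0; rewrite mulr0 addr0 scale1r.
have d0 := gegen_den_gt0 k.
exists ((k.+2%:R + p - 3)^-1 * (2 * k.+2%:R + p - 4) * a).
  rewrite !mulr_gt0 ?invr_gt0 //.
  by have := ler0n R k; rewrite -(addn2 k) natrD; move: trP_gt1; rewrite -/p; lra.
move=> y; have [q Eq] := Ea y.
exists ((k.+2%:R + p - 3)^-1 *: ((2 * k.+2%:R + p - 4) *: (zlin y * q)
        - ((k.+2%:R - 1) * bform y y) *: zpoly y k)).
rewrite {1}/zpoly -/(zpoly y k.+1) -/(zpoly y k) Eq !exprS -!mul_mpolyC; ring.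
Qed.

Lemma fischer_zpoly l : exists2 a : R, 0 < a &
  forall x y, fischer (zpoly x l) (zpoly y l) = a * zonal l x y.
Proof.
have [a a0 Ea] : exists2 a : R, 0 < a &
    forall y, exists q, zpoly y l = a *: zlin y ^+ l + sqform * q.
  exact: zpoly_lead.
exists (a * l`!%:R); first by rewrite mulr_gt0 // ltr0n fact_gt0.
move=> x y; have [q Eq] := Ea y; rewrite [in zpoly y l]Eq fischerDr fischerZr.
by rewrite fischer_zpoly_zlin mulrA [X in _ + X]fischerC fischer_sqform lap_zpoly
   fischer0r addr0.
Qed.

Lemma meval_sqform x : meval (fun i => x i 0) sqform = bform x x.
Proof.
rewrite /sqform raddf_sum /bform -dot_proj dotE; apply: eq_bigr => i _.
by rewrite /= mevalM meval_linform dotC dot_col.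
Qed.

Lemma meval_zpoly x y l : meval (fun i => x i 0) (zpoly y l) = zonal l x y.
Proof.
elim/nat_ind2: l => [||k IH0 IH1]; first exact: meval1.
  by rewrite /= meval_linform.
have d0 := lt0r_neq0 (gegen_den_gt0 k).
apply: (mulfI d0); rewrite -mevalZ zpolySS mevalB !mevalZ !mevalM IH0 IH1.
by rewrite meval_linform meval_sqform gegenbauer_recSS /zonal /bform; ring.
Qed.

Lemma zonalC l x y : zonal l x y = zonal l y x.
Proof. by rewrite /zonal bformC mulrC. Qed.

(** By [fischer_zpoly] the zonal kernel is a positive combination, over the monomials, of rank-one
    kernels. Multiplying [N] by one of these only rescales the test vector [c]. *)
Lemma psd_zonal_mul (I : finType) (x : I -> 'cV[R]_n) (N : I -> I -> R) l :
  psd N -> psd (fun i j => zonal l (x i) (x j) * N i j).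
Proof.
case=> N_sym N_ge0; split=> [i j|c].
  by rewrite zonalC N_sym.
have [a a0 Ea] := fischer_zpoly l.
pose k := (\max_i msize (zpoly (x i) l))%N.
have Ez i j : zonal l (x i) (x j) = a^-1 * \sum_(m : bmultinom n k)
    mfactorial R m * mcoeff m (zpoly (x i) l) * mcoeff m (zpoly (x j) l).
  rewrite -(@fischerE _ _ k) ?Ea ?mulKf ?gt_eqF //.
  by apply: (@leq_bigmax _ (fun i => msize (zpoly (x i) l))).
have -> : \sum_i \sum_j c i * (zonal l (x i) (x j) * N i j) * c j =
    a^-1 * \sum_(m : bmultinom n k) mfactorial R m * \sum_i \sum_j
      (c i * mcoeff m (zpoly (x i) l)) * N i j * (c j * mcoeff m (zpoly (x j) l)).
  rewrite mulr_sumr; under [RHS]eq_bigr do rewrite !mulr_sumr.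
  rewrite [RHS]exchange_big; apply: eq_bigr => i _ /=.
  under [RHS]eq_bigr do rewrite !mulr_sumr.
  rewrite [RHS]exchange_big; apply: eq_bigr => j _ /=.
  rewrite Ez mulr_sumr mulr_suml mulr_sumr mulr_suml; apply: eq_bigr => m _.
  ring.
rewrite mulr_ge0 ?invr_ge0 ?(ltW a0) // sumr_ge0 // => m _.
by rewrite mulr_ge0 ?N_ge0 // ltW // mfactorial_gt0.
Qed.

Definition usphere x := P *m x = x /\ dot x x = 1.

Lemma usphere_normalize x : bform x x != 0 ->
  usphere ((Num.sqrt (bform x x))^-1 *: (P *m x)).
Proof.
move=> x0; have x_gt0 : 0 < bform x x by rewrite lt_def x0 /bform -dot_proj dot_ge0.
split; first by rewrite -scalemxAr mulmxA P_idem.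
rewrite dotZl dotZr dot_proj -/(bform x x) mulrA -invfM -expr2 sqr_sqrtr ?ltW //.
by rewrite mulVf.
Qed.

Lemma usphere_neq0 : exists e, usphere e.
Proof.
suff [x x0] : exists x, bform x x != 0.
  by exists ((Num.sqrt (bform x x))^-1 *: (P *m x)); apply: usphere_normalize.
have [i Pi] : exists i, P i i != 0.
  apply/existsP; rewrite -negb_forall; apply/negP => /forallP P0.
  move: trP_gt1; rewrite /mxtrace big1 ?ltr10 // => i _; exact/eqP.
by exists (col i P); rewrite /bform proj_col dot_col proj_col mxE.
Qed.

Lemma bform_usphere x : usphere x -> bform x x = 1.
Proof. by case=> Px x1; rewrite /bform Px. Qed.

Lemma usphereN x : usphere x -> usphere (- x).
Proof.
by case=> Px x1; split; rewrite ?mulmxN ?Px // -scaleN1r dotZl dotZr x1; ring.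
Qed.

(** The recursion is homogeneous of degree [l] when [h] has weight 2 and [w] has weight 1. The case
    [c = 0] is allowed and handles degenerate labels. *)
Lemma gegenbauer_rec_scale c h w l :
  gegenbauer_rec p (c ^+ 2 * h) (c * w) l = c ^+ l * gegenbauer_rec p h w l.
Proof.
elim/nat_ind2: l => [||k IH0 IH1]; [by rewrite expr0 mul1r|by rewrite expr1|].
have d0 := lt0r_neq0 (gegen_den_gt0 k).
by apply: (mulfI d0); rewrite [RHS]mulrCA !gegenbauer_recSS IH0 IH1 !exprS; ring.
Qed.

Lemma zonal_usphere_diag l x : usphere x -> zonal l x x = 1.
Proof.
move=> xS; rewrite /zonal bform_usphere // mulr1.
elim/nat_ind2: l => [//|//|k IH0 IH1].
have d0 := lt0r_neq0 (gegen_den_gt0 k).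
by apply: (mulfI d0); rewrite !gegenbauer_recSS IH0 IH1; ring.
Qed.

Lemma zonalZ l c x y : zonal l (c *: x) y = c ^+ l * zonal l x y.
Proof.
rewrite -gegenbauer_rec_scale /zonal /bform -scalemxAr !(dotZl, dotZr).
by rewrite [dot x (P *m y)]lock; congr gegenbauer_rec; rewrite -?lock; ring.
Qed.

Lemma zonal_proj l x y : zonal l (P *m x) y = zonal l x y.
Proof. by rewrite /zonal /bform !dot_proj mulmxA P_idem. Qed.

(** * Linear independence of harmonics of different degrees *)

Section Directness.
Variables (I : finType) (b : nat -> I -> R) (y : I -> 'cV[R]_n).

Let q j := \sum_i b j i *: zpoly (y i) j.

Lemma meval_zpoly_sum x j : meval (fun i => x i 0) (q j) = \sum_i b j i * zonal j x (y i).
Proof.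
by rewrite /q raddf_sum; apply: eq_bigr => i _; rewrite /= mevalZ meval_zpoly.
Qed.

Lemma lap_zpoly_sum j : lap (q j) = 0.
Proof.
rewrite /q; elim/big_ind: _ => [|f g f0 g0|i _].
- by have := lapZ 0 0; rewrite !scale0r.
- by rewrite -[g]opprK -[- g]scaleN1r lapB lapZ f0 g0 scaler0 subr0.
- by rewrite lapZ lap_zpoly scaler0.
Qed.

Lemma sqform_neq0 : sqform != 0.
Proof.
have [e eS] := usphere_neq0; apply/eqP => s0.
have := meval_sqform e; rewrite s0 meval0 bform_usphere // => /eqP.
by rewrite eq_sym oner_eq0.
Qed.

(* On the sphere the even part of the relation can be homogenized with powers of
   [sqform]. The top summand [q d] is then harmonic and a multiple of [sqform], so
   it is Fischer-orthogonal to itself. *)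
Lemma zpoly_sum_independent d :
  (forall x, usphere x -> \sum_(j < d) meval (fun i => x i 0) (q j) = 0) ->
  forall j, (j < d)%N -> q j = 0.
Proof.
elim: d => [//|d IH] q0.
pose Q := \sum_(j < d.+1 | ~~ odd (d - j)) sqform ^+ (d - j)./2 * q j.
have Q0 : Q = 0.
  (* The factor [sqform] settles the points with [P x = 0], which cannot be normalized. *)
  suff : sqform * Q = 0 by move/eqP; rewrite mulf_eq0 (negPf sqform_neq0) => /eqP.
  apply: meval_eq0 => v; pose x := \col_i v i.
  rewrite (@meval_eq _ _ v (fun i => x i 0)) => [|i]; last by rewrite mxE.
  rewrite mevalM meval_sqform.
  have [->|x0] := eqVneq (bform x x) 0; first by rewrite mul0r.
  set r := Num.sqrt (bform x x).
  have r2 : r ^+ 2 = bform x x by rewrite sqr_sqrtr // /bform -dot_proj dot_ge0.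
  have r0 : r != 0 by apply: contraNneq x0 => r0; rewrite -r2 r0 expr0n.
  have eS := usphere_normalize x0.
  rewrite -/r in eS; set e := r^-1 *: (P *m x) in eS.
  have qx j : meval (fun i => x i 0) (q j) = r ^+ j * meval (fun i => e i 0) (q j).
    rewrite !meval_zpoly_sum mulr_sumr; apply: eq_bigr => i _.
    rewrite /e zonalZ zonal_proj mulrCA [r ^+ j * _]mulrA -exprMn divff //.
    by rewrite expr1n mul1r.
  have qN j : meval (fun i => (- e) i 0) (q j) = (-1) ^+ j * meval (fun i => e i 0) (q j).
    rewrite !meval_zpoly_sum mulr_sumr; apply: eq_bigr => i _.
    by rewrite -[- e]scaleN1r zonalZ mulrCA.
  (* Adding the relation at [e] and $(-1)^d$ times the relation at [- e] keeps only the degrees of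
     the parity of [d]. *)
  have ev : \sum_(j < d.+1 | ~~ odd (d - j)) meval (fun i => e i 0) (q j) = 0.
    have := q0 _ (usphereN eS); under eq_bigr do rewrite qN.
    move=> /(congr1 ( *%R ((-1) ^+ d))); rewrite mulr0 => qN0.
    have : 2 * \sum_(j < d.+1 | ~~ odd (d - j)) meval (fun i => e i 0) (q j) =
      \sum_(j < d.+1) meval (fun i => e i 0) (q j) + (-1) ^+ d *
      \sum_(j < d.+1) (-1) ^+ j * meval (fun i => e i 0) (q j).
      rewrite !mulr_sumr -big_split big_mkcond /=; apply: eq_bigr => j _.
      have -> : (-1) ^+ d * ((-1) ^+ j * meval (fun i => e i 0) (q j)) =
         (-1) ^+ odd (d - j) * meval (fun i => e i 0) (q j).
        rewrite mulrA -exprD -signr_odd; congr ((-1) ^+ (nat_of_bool _) * _).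
        by rewrite oddD oddB // -ltnS ltn_ord.
      by case: odd; rewrite /= ?expr1 ?expr0; ring.
    by move/eqP; rewrite q0 // qN0 addr0 mulf_eq0 pnatr_eq0 /= => /eqP.
  rewrite /Q raddf_sum /=
    (eq_bigr (fun j : 'I_d.+1 => r ^+ d * meval (fun i => e i 0) (q j))).
    by rewrite -mulr_sumr ev !mulr0.
  move=> j dj; rewrite mevalM qx rmorphXn /= meval_sqform -r2 -exprM mulrA -exprD.
  congr (r ^+ _ * _); rewrite mulnC muln2 halfK (negPf dj) subn0 subnK //.
  by rewrite -ltnS ltn_ord.
have qd : q d = 0.
  apply: fischer_eq0; move: Q0; rewrite /Q big_mkcond big_ord_recr /= subnn /= expr0 mul1r.
  (* Here [d - j] is even and positive, hence at least 2, so one factor [sqform] comes out. *)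
  have -> : \sum_(j < d) (if ~~ odd (d - j) then sqform ^+ (d - j)./2 * q j else 0) =
    sqform * \sum_(j < d | ~~ odd (d - j)) sqform ^+ (d - j)./2.-1 * q j.
    rewrite mulr_sumr big_mkcond [RHS]big_mkcond; apply: eq_bigr => j _.
    case: ifP => // dj; rewrite mulrA -exprS prednK // half_gt0.
    by have := subn_gt0 j d; rewrite ltn_ord; case: (d - j)%N dj => [|[|]].
  set Q' := \sum_(j < d | _) _ => /(congr1 (fischer (q d))).
  rewrite fischerDr fischer0r [X in X + _]fischerC fischer_sqform lap_zpoly_sum fischer0r.
  by rewrite add0r.
move=> j; rewrite ltnS leq_eqVlt => /predU1P[->//|]; apply: IH => x xS.
by have := q0 x xS; rewrite big_ord_recr /= qd meval0 addr0.
Qed.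
End Directness.

(** A bound uniform in [y] places all these harmonics in one finite-dimensional space, as
    [finite_span] requires. *)
Lemma zpoly_bound d : exists K, forall j y, (j < d)%N -> (msize (zpoly y j) <= K)%N.
Proof.
have B j : exists K, forall y, (msize (zpoly y j) <= K)%N.
  have lin_le (v : 'cV[R]_n) : (msize (linform v) <= 2)%N.
    rewrite /linform; apply: (leq_trans (msize_sum _ _ _)).
    apply/bigmax_leqP => i _; apply: leq_trans (msizeZ_le _ _) _.
    by rewrite msizeX mdeg1.
  have sq_le : (msize sqform <= 5)%N.
    apply: (leq_trans (msize_sum _ _ _)); apply/bigmax_leqP => i _.
    rewrite expr2; apply: leq_trans (msizeM_le _ _) _.
    by rewrite ltnS (leq_add (lin_le _) (lin_le _)).
  elim/nat_ind2: j => [||k [K0 H0] [K1 H1]].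
  - by exists 1%N => y; rewrite msize1.
  - by exists 2 => y; apply: lin_le.
  exists (maxn (2 + K1).+1 (5 + K0).+1) => y; rewrite [zpoly y k.+2]/=.
  apply: leq_trans (msizeZ_le _ _) _.
  apply: leq_trans (msizeD_le _ _) _; rewrite geq_max; apply/andP; split.
    apply: leq_trans (msizeZ_le _ _) _; rewrite leq_max; apply/orP; left.
    by apply: leq_trans (msizeM_le _ _) _; rewrite ltnS; apply: leq_add (lin_le _) (H1 y).
  rewrite msizeN; apply: leq_trans (msizeZ_le _ _) _; rewrite leq_max; apply/orP; right.
  by apply: leq_trans (msizeM_le _ _) _; rewrite ltnS; apply: leq_add sq_le (H0 y).
elim: d => [|d [K HK]]; first by exists 0%N.
have [K' HK'] := B d; exists (maxn K K') => j y; rewrite ltnS leq_eqVlt leq_max.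
by case/predU1P => [->|/(HK _ y) -> //]; rewrite HK' orbT.
Qed.

(** The spanned vectors list the coefficients in all degrees below [d] together, so the same weights
    [b] serve every degree. *)
Lemma zpoly_finite_span d : exists k (t : 'I_k -> 'cV[R]_n), (forall i, usphere (t i)) /\
  forall x, usphere x -> exists b : 'I_k -> R,
    forall j, (j < d)%N -> zpoly x j = \sum_i b i *: zpoly (t i) j.
Proof.
have [K HK] := zpoly_bound d.
pose I : finType := ('I_d * bmultinom n K)%type.
pose z y := \row_(k < #|I|)
  let: (j, m) := (enum_val k : 'I_d * bmultinom n K) in mcoeff m (zpoly y j).
have [k [t [tS span]]] := finite_span usphere z.
exists k, t; split=> // x /span[b Eb]; exists b => j jd; apply/mpolyP => m.
have [mK|mK] := ltnP (mdeg m) K; last first.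
  have out y : mcoeff m (zpoly y j) = 0.
    by apply/memN_msupp_eq0/msize_mdeg_ge; apply: leq_trans mK; apply: HK.
  rewrite out linear_sum big1 // => i _.
  by rewrite /= mcoeffZ out mulr0.
have := congr1 (fun r : 'rV_#|I| => r 0 (enum_rank (Ordinal jd, BMultinom mK))) Eb.
rewrite mxE enum_rankK /= => ->; rewrite summxE linear_sum; apply: eq_bigr => i _.
by rewrite !mxE enum_rankK /= mcoeffZ.
Qed.

(** A discrete substitute for the orthogonality of harmonics under integration. It suffices to find
    a row [c] annihilating every [Z j] with [j != l] but not [Z l], and to rescale it. *)
Lemma zonal_separation d l : (l < d)%N ->
  exists k (c : 'I_k -> R) (t : 'I_k -> 'cV[R]_n), (forall i, usphere (t i)) /\
    forall j, (j < d)%N ->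
      \sum_a \sum_b c a * zonal j (t a) (t b) * c b = (j == l)%:R.
Proof.
move=> ld; have [k [t [tS tspan]]] := zpoly_finite_span d.
pose Z j := \matrix_(a, b) zonal j (t a) (t b).
suff [c cZ0 cZ] : exists2 c : 'rV[R]_k,
    forall j, (j < d)%N -> j != l -> c *m Z j = 0 & c *m Z l != 0.
  have [a a0 Ea] := fischer_zpoly l.
  pose f := \sum_i c 0 i *: zpoly (t i) l.
  have sumZ j b : (c *m Z j) 0 b = \sum_i c 0 i * zonal j (t i) (t b).
    by rewrite mxE; apply: eq_bigr => i _; rewrite mxE.
  have ff : fischer f f = a * \sum_i \sum_b c 0 i * zonal l (t i) (t b) * c 0 b.
    rewrite /f fischer_suml mulr_sumr; apply: eq_bigr => i _.
    rewrite fischerZl fischer_sumr !mulr_sumr; apply: eq_bigr => b _.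
    by rewrite fischerZr Ea; ring.
  set s := \sum_i _ in ff.
  have s_gt0 : 0 < s.
    (* [a * s] is the Fischer square norm of [f]. If it were 0, then [f] and its values [c *m Z l]
       at the points would vanish. *)
    have := fischer_ge0 f; rewrite ff pmulr_rge0 // le_eqVlt => /predU1P[s0|//].
    move: ff; rewrite -s0 mulr0 => /fischer_eq0 f0.
    case/eqP: cZ; apply/matrixP => i b; rewrite (ord1 i) sumZ mxE.
    have := meval_zpoly_sum (fun=> c 0) t (t b) l.
    rewrite -/f f0 meval0 => E; rewrite [RHS]E.
    by apply: eq_bigr => j _; rewrite zonalC.
  exists k, (fun i => (Num.sqrt s)^-1 * c 0 i), t; split=> // j jd.
  have -> : \sum_i \sum_b (Num.sqrt s)^-1 * c 0 i * zonal j (t i) (t b) *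
      ((Num.sqrt s)^-1 * c 0 b) =
      s^-1 * \sum_i \sum_b c 0 i * zonal j (t i) (t b) * c 0 b.
    rewrite -[in s^-1](sqr_sqrtr (ltW s_gt0)) -exprVn expr2 mulr_sumr.
    apply: eq_bigr => i _.
    by rewrite mulr_sumr; apply: eq_bigr => b _; ring.
  have [->|jl] := eqVneq j l; first by rewrite mulVf // gt_eqF.
  rewrite exchange_big big1 ?mulr0 // => b _; rewrite -mulr_suml -sumZ cZ0 //.
  by rewrite mxE mul0r.
(* Otherwise the rows of [Z l] are combinations of the rows of the other [Z j],
   contradicting the independence of the harmonics of different degrees. *)
apply: contrapT => no_c.
pose I : finType := ('I_d * 'I_k)%type.
pose N := \matrix_(a < k, J < #|I|)
  let: (j, b) := (enum_val J : 'I_d * 'I_k) in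
  if val j == l then 0 else zonal j (t a) (t b).
have [X EX] : exists X, (Z l)^T = X *m N^T.
  apply/submxP; rewrite submxE; apply/negPn/negP => nz.
  (* The rows of [(cokermx N^T)^T] are solutions [c] of [c *m N = 0]; one that [Z l] does not kill
     is the excluded [c]. *)
  have [i ri] : exists i, row i ((cokermx N^T)^T *m Z l) != 0.
    apply/existsP; rewrite -negb_forall; apply: contra nz => /forallP r0.
    rewrite -trmx_eq0 trmx_mul trmxK; apply/eqP/row_matrixP => i.
    by rewrite row0; apply/eqP.
  apply: no_c; exists (row i (cokermx N^T)^T); last by rewrite -row_mul.
  move=> j jd jl; apply/matrixP => a b; rewrite (ord1 a) mxE.
  have := congr1 (fun A : 'M[R]_(_, _) => A (enum_rank (Ordinal jd, b)) i) (mulmx_coker N^T).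
  rewrite !mxE => E; rewrite -[RHS]E; apply: eq_bigr => a' _.
  by rewrite !mxE enum_rankK /= (negPf jl) mulrC.
have k_gt0 : (0 < k)%N.
  rewrite lt0n; apply/eqP => k0; have [e eS] := usphere_neq0.
  have [b /(_ 0%N (leq_trans (ltn0Sn l) ld))] := tspan e eS.
  rewrite big1 => [/eqP|i _]; first by rewrite oner_eq0.
  by have := ltn_ord i; rewrite [X in (_ < X)%N]k0.
pose a := Ordinal k_gt0.
(* Weights of a vanishing relation: degree [l] carries only the harmonic of [t a], the other degrees
   minus the coefficients [X] expressing row [a]. *)
pose B j i := if j == l then (i == a)%:R
  else - oapp (fun j' : 'I_d => X a (enum_rank (j', i))) 0 (insub j).
have Bt i' : \sum_(j < d) \sum_i B j i * zonal j (t i') (t i) = 0.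
  have := congr1 (fun A : 'M[R]_k => A a i') EX; rewrite !mxE.
  rewrite (reindex (@enum_rank I)) /=; last by apply: onW_bij; apply: enum_rank_bij.
  rewrite (eq_bigr (fun J : 'I_d * 'I_k => X a (enum_rank (J.1, J.2)) *
    N^T (enum_rank (J.1, J.2)) i')) => [|[]//].
  rewrite -(pair_bigA _ (fun j i => X a (enum_rank (j, i)) * N^T (enum_rank (j, i)) i')) /=.
  move=> E; rewrite (bigD1 (Ordinal ld)) //= [X in X + _](bigD1 a) //= {1}/B !eqxx mul1r.
  rewrite [X in _ + X + _]big1 => [|i /negPf ia]; last by rewrite /B eqxx ia mul0r.
  rewrite addr0 E (bigD1 (Ordinal ld)) //= [X in X + _ + _]big1 => [|i _]; last first.
    by rewrite !mxE enum_rankK /= eqxx mulr0.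
  rewrite add0r -big_split big1 // => j /negPf jl /=.
  rewrite -big_split big1 // => i _ /=.
  rewrite /B -[val j == l]/(j == Ordinal ld) jl valK /= !mxE enum_rankK /=.
  by rewrite -[val j == l]/(j == Ordinal ld) jl mulNr subrr.
(* The relation [Bt] at the points [t] extends to the whole unit sphere of W, since the weights [b]
   are common to all degrees. *)
have /(@zpoly_sum_independent _ B t) : forall x, usphere x ->
    \sum_(j < d) meval (fun i => x i 0) (\sum_i B j i *: zpoly (t i) j) = 0.
  move=> x xS; have [b Eb] := tspan x xS.
  under eq_bigr => j _.
    rewrite meval_zpoly_sum
      (eq_bigr (fun i => \sum_i' b i' * (B j i * zonal j (t i') (t i)))).
      rewrite exchange_big /=; over.
    move=> i _; rewrite zonalC -meval_zpoly Eb // raddf_sum mulr_sumr.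
    apply: eq_bigr => i' _.
    by rewrite /= mevalZ meval_zpoly mulrCA [in LHS]zonalC.
  rewrite exchange_big big1 // => i' _ /=.
  by under eq_bigr do rewrite -mulr_sumr; rewrite -mulr_sumr Bt mulr0.
move=> /(_ l ld) /(congr1 (meval (fun i => t a i 0))).
rewrite meval_zpoly_sum meval0 (bigD1 a) //= /B !eqxx mul1r zonal_usphere_diag //.
rewrite big1 => [|i].
  by move/eqP; rewrite addr0 oner_eq0.
by move=> /negPf ->; rewrite mul0r.
Qed.

End Zonal.

(** * Recovery of the coefficient matrices *)

Lemma quad_formE (R : realType) k (M : 'M[R]_k) (c : 'cV[R]_k) :
  \sum_i \sum_j c i 0 * M i j * c j 0 = (c^T *m M *m c) 0 0.
Proof.
rewrite -mulmxA mxE; apply: eq_bigr => i _; rewrite !mxE mulr_sumr.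
by apply: eq_bigr => j _; rewrite mulrA.
Qed.

(** * Projection away from the code, and the sphere points above a label *)

Section CodeProjection.
Variables (R : realType) (n m : nat) (A : 'M[R]_(n, m)).
Let G := A^T *m A.
Hypotheses (G_unit : G \in unitmx) (mn : (m + 2 <= n)%N).
Implicit Types (x y : 'cV[R]_n) (u v : 'cV[R]_m).

(** The orthogonal projection onto the complement of the span of the code. *)
Definition code_proj : 'M[R]_n := 1%:M - A *m invmx G *m A^T.
Let P := code_proj.

Let G_sym : G^T = G.
Proof. by rewrite /G trmx_mul trmxK. Qed.

Lemma code_proj_sym : P^T = P.
Proof.
by rewrite /P /code_proj linearB /= trmx1 !trmx_mul trmxK trmx_inv G_sym mulmxA.
Qed.

Lemma mul_tr_code_proj : A^T *m P = 0.
Proof.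
by rewrite /P /code_proj mulmxBr mulmx1 !mulmxA -/G mulmxV // mul1mx subrr.
Qed.

Lemma code_proj_idem : P *m P = P.
Proof.
rewrite {1}/P /code_proj mulmxBl mul1mx -[_ *m A^T *m _]mulmxA mul_tr_code_proj.
by rewrite mulmx0 subr0.
Qed.

Lemma code_proj_tr : \tr P = n%:R - m%:R.
Proof.
rewrite /P /code_proj raddfB /= mxtrace1 mxtrace_mulC mulmxA -/G mulmxV //.
by rewrite mxtrace1.
Qed.

Lemma code_proj_tr_gt1 : 1 < \tr P.
Proof.
by rewrite code_proj_tr ltrBrDr -(natrD _ 1) ltr_nat add1n -addn2.
Qed.

Lemma bform_code_proj x y : bform P x y = dot x y - ginv G (A^T *m x) (A^T *m y).
Proof.
rewrite /bform /P /code_proj mulmxBl mul1mx -scaleN1r dotDr dotZr mulN1r.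
congr (_ - _); rewrite -!mulmxA dotC dot_mulmxl dotC /dot /ginv.
by rewrite -!mulmxA.
Qed.

Lemma Pnm_zonal l x y :
  Pnm n l G (A^T *m x) (A^T *m y) (dot x y) =
  gegenbauer_rec (\tr P) ((1 - dot x x + bform P x x) * (1 - dot y y + bform P y y))
    (bform P x y) l.
Proof.
rewrite /Pnm code_proj_tr !bform_code_proj; congr (gegenbauer_rec _ (_ * _) _ _).
  ring.
ring.
Qed.

Lemma Pnm_sphere l x y : dot x x = 1 -> dot y y = 1 ->
  Pnm n l G (A^T *m x) (A^T *m y) (dot x y) = zonal P l x y.
Proof. by move=> x1 y1; rewrite Pnm_zonal x1 y1 subrr !add0r. Qed.

(* The paper's [h_u]. *)
Definition hgt u : R := 1 - ginv G u u.

Lemma ginvC u v : ginv G u v = ginv G v u.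
Proof.
rewrite /ginv -[in LHS](trmxK (u^T *m _ *m _)) mxE !trmx_mul trmxK trmx_inv G_sym.
by rewrite mulmxA.
Qed.

(** A point above [u]: the label fixes its component in the span of the code, and [x] is the
    direction of its component in W, of length $\sqrt{h_u}$. *)
Definition lift_pt u x : 'cV[R]_n := A *m invmx G *m u + Num.sqrt (hgt u) *: x.

Lemma tr_usphere x : usphere P x -> A^T *m x = 0.
Proof. by case=> <- _; rewrite mulmxA mul_tr_code_proj mul0mx. Qed.

Lemma tr_lift_pt u x : usphere P x -> A^T *m lift_pt u x = u.
Proof.
move=> xS; rewrite /lift_pt mulmxDr -scalemxAr (tr_usphere xS) scaler0 addr0.
by rewrite !mulmxA -/G mulmxV // mul1mx.
Qed.

Lemma dot_lift_pt u v x y : usphere P x -> usphere P y ->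
  dot (lift_pt u x) (lift_pt v y) =
  ginv G u v + Num.sqrt (hgt u) * Num.sqrt (hgt v) * dot x y.
Proof.
have perp c z : usphere P z -> dot (A *m c) z = 0.
  by move=> zS; rewrite dot_mulmxl tr_usphere // /dot mulmx0 mxE.
move=> xS yS; rewrite /lift_pt -!mulmxA dotDl !dotDr !dotZl !dotZr (dotC x).
rewrite (perp _ _ xS) (perp _ _ yS) !mulr0 addr0 add0r mulrA; congr (_ + _).
rewrite dot_mulmxl mulmxA -/G mulKVmx // /dot trmx_mul trmx_inv G_sym.
by rewrite /ginv.
Qed.

Lemma lift_pt_sphere u x : usphere P x -> 0 <= hgt u -> dot (lift_pt u x) (lift_pt u x) = 1.
Proof.
move=> xS u0; rewrite dot_lift_pt // -expr2 sqr_sqrtr // (proj2 xS) /hgt; ring.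
Qed.

Lemma triple_lift_pt u v x y : usphere P x -> usphere P y ->
  triple A (lift_pt u x) (lift_pt v y) =
  (ginv G u v + Num.sqrt (hgt u) * Num.sqrt (hgt v) * dot x y, u, v).
Proof. by move=> xS yS; rewrite /triple dot_lift_pt // !tr_lift_pt. Qed.

Lemma Pnm_lift_pt l u v x y : usphere P x -> usphere P y -> 0 <= hgt u -> 0 <= hgt v ->
  Pnm n l G u v (ginv G u v + Num.sqrt (hgt u) * Num.sqrt (hgt v) * dot x y) =
  Num.sqrt (hgt u) ^+ l * Num.sqrt (hgt v) ^+ l * zonal P l x y.
Proof.
move=> xS yS u0 v0; rewrite /Pnm -code_proj_tr -exprMn /zonal.
rewrite -(gegenbauer_rec_scale code_proj_tr_gt1) !bform_usphere //.
congr gegenbauer_rec; first by rewrite !mulr1 exprMn !sqr_sqrtr.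
by rewrite /bform (proj1 yS) addrC addKr.
Qed.

(** This is the Schur complement of the block [G], reached with the test vector whose first block is
    $-G^{-1}(au+bv)$. *)
Lemma psd_Hmx_schur u v t : psd (fun i j => Hmx G u v t i j) ->
  forall a b : R, 0 <= a ^+ 2 * hgt u + b ^+ 2 * hgt v + 2 * a * b * (t - ginv G u v).
Proof.
case=> _ H a b; pose z := a *: u + b *: v.
pose c : 'cV[R]_(m + (1 + 1)) := col_mx (- (invmx G *m z)) (col_mx a%:M b%:M).
have := H (fun i => c i 0).
rewrite quad_formE /c /Hmx !tr_col_mx !tr_scalar_mx mul_row_block.
rewrite !mul_row_col !mul_scalar_mx.
have zt : z^T = a *: u^T + b *: v^T by rewrite /z linearD !linearZ.
rewrite -zt [(- _)^T]linearN /=; set q := (invmx G *m z)^T.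
have qG : q = z^T *m invmx G by rewrite /q trmx_mul trmx_inv G_sym.
have qE w : q *m w = (a * ginv G u w + b * ginv G v w)%:M.
  rewrite [LHS]mx11_scalar qG zt !mulmxDl -!scalemxAl; congr _%:M.
  by rewrite mxE [X in X + _]mxE [X in _ + X]mxE.
rewrite mulNmx {1}qG mulmxKV // addNr mul0mx add0r mulNmx mul_mx_row !qE.
rewrite !scale_row_mx !add_row_mx -[- row_mx _ _]scaleN1r scale_row_mx add_row_mx.
rewrite mul_row_col !mul_mx_scalar (ginvC v u).
rewrite !mxE /= !mulr1n /hgt; congr (0 <= _); ring.
Qed.
(** A zero diagonal entry of the 2 by 2 Schur complement forces its off-diagonal entry $w$ to be 0.
    With $h_uh_v = w = 0$, homogeneity at [c = 0] kills every positive degree. *)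
Lemma Pnm_degenerate l u v t : psd (fun i j => Hmx G u v t i j) ->
  hgt u * hgt v = 0 -> Pnm n l.+1 G u v t = 0.
Proof.
move=> /psd_Hmx_schur Q uv0.
suff w0 : t - ginv G u v = 0.
  rewrite /Pnm w0 -/(hgt u) -/(hgt v) uv0 -code_proj_tr.
  have := gegenbauer_rec_scale code_proj_tr_gt1 0 1 1 l.+1.
  by rewrite [0 ^+ 2]exprS [0 ^+ l.+1]exprS !mul0r.
apply/eqP/negPn/negP; set w := t - _ in Q * => w0.
have [u0|v0] : hgt u = 0 \/ hgt v = 0.
  by move/eqP: uv0; rewrite mulf_eq0 => /orP[]/eqP; [left|right].
(* The first coordinate is chosen so that the form takes the value -1. *)
- have := Q (- (hgt v + 1) / (2 * w)) 1; rewrite u0 mulr0 add0r.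
  have -> : 1 ^+ 2 * hgt v + 2 * (- (hgt v + 1) / (2 * w)) * 1 * w = - 1 by field.
  by rewrite oppr_ge0 ler10.
- have := Q 1 (- (hgt u + 1) / (2 * w)); rewrite v0 mulr0 addr0.
  have -> : 1 ^+ 2 * hgt u + 2 * 1 * (- (hgt u + 1) / (2 * w)) * w = - 1 by field.
  by rewrite oppr_ge0 ler10.
Qed.
End CodeProjection.

(** * Expansion of polynomials in [t] in the Gegenbauer basis *)

Section GegenbauerBasis.
Variables (R : realType) (p h w0 : R).
Hypothesis p_gt1 : 1 < p.

(** Each step multiplies the leading coefficient by $(2l+p-4)/(l+p-3)$, nonzero since $p>1$, so the
    degree is exactly [l]. *)
Lemma gegenbauer_poly l : exists g : {poly R}, size g = l.+1 /\
  forall t, g.[t] = gegenbauer_rec p h (t - w0) l.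
Proof.
have X0 : size ('X - w0%:P) = 2%N by rewrite size_XsubC.
elim/nat_ind2: l => [||k [g0 [s0 E0]] [g1 [s1 E1]]].
- by exists 1; rewrite size_poly1; split=> // t; rewrite hornerC.
- by exists ('X - w0%:P); rewrite X0; split=> // t; rewrite hornerXsubC.
have k_ge0 := ler0n R k.
have d0 : k.+2%:R + p - 3 != 0 :> R.
  by rewrite gt_eqF // -addn2 natrD; move: p_gt1 k_ge0; lra.
have a0 : 2 * k.+2%:R + p - 4 != 0 :> R.
  by rewrite gt_eqF // -addn2 natrD; move: p_gt1 k_ge0; lra.
exists ((k.+2%:R + p - 3)^-1 *: ((2 * k.+2%:R + p - 4) *: (('X - w0%:P) * g1)
   - ((k.+2%:R - 1) * h) *: g0)); split=> [|t]; last first.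
  rewrite !(hornerE, E0, E1) /=; field.
  by rewrite [2 + _]addrC -natrD addn2.
have g1_neq0 : g1 != 0 by rewrite -size_poly_eq0 s1.
have sM : size ((2 * k.+2%:R + p - 4) *: (('X - w0%:P) * g1)) = k.+3.
  by rewrite size_scale // size_proper_mul ?X0 ?s1 // lead_coefXsubC mul1r lead_coef_eq0.
rewrite size_scale ?invr_eq0 // size_polyDl sM // size_polyN.
by apply: leq_ltn_trans (size_scale_leq _ _) _; rewrite s0.
Qed.

Lemma gegenbauer_expansion d (q : {poly R}) : (size q <= d)%N ->
  exists f : nat -> R, forall t,
    q.[t] = \sum_(j < d) gegenbauer_rec p h (t - w0) j * f j.
Proof.
elim: d q => [q|d IH q qd].
  rewrite leqn0 size_poly_eq0 => /eqP ->; exists (fun=> 0) => t.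
  by rewrite big_ord0 horner0.
have [g [sg Eg]] := gegenbauer_poly d.
have gd0 : g`_d != 0.
  by have := lead_coef_eq0 g; rewrite /lead_coef sg /= -size_poly_eq0 sg => ->.
have [|f Ef] := IH (q - (q`_d / g`_d) *: g).
  apply/leq_sizeP => j; rewrite leq_eqVlt => /predU1P[<-|dj].
    by rewrite coefB coefZ divfK // subrr.
  by rewrite coefB coefZ (nth_default _ (leq_trans qd dj)) [g`_j]nth_default ?sg // mulr0 subrr.
exists (fun j => if j == d then q`_d / g`_d else f j) => t.
rewrite big_ord_recr /= eqxx -Eg.
have := Ef t; rewrite hornerD hornerN hornerZ => /eqP; rewrite subr_eq => /eqP ->.
rewrite [_ * g.[t]]mulrC; congr (_ + _); apply: eq_bigr => j _.
by rewrite (ltn_eqF (ltn_ord j)).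
Qed.
End GegenbauerBasis.

Lemma tuv_eval_poly (R : realType) (m d : nat) (F : tuv_poly R m) u v :
  tdeg_le d F -> exists2 q : {poly R}, (size q <= d.+1)%N &
    forall t, tuv_eval F (t, u, v) = q.[t].
Proof.
move=> Fd.
pose w : 'rV[R]_(m + m) := row_mx u^T v^T.
exists (\sum_(k <- msupp F) (mcoeff k F * \prod_(i < m + m) w 0 i ^+ k (rshift 1 i))
    *: 'X^(k (lshift (m + m) ord0))).
  rewrite big_seq; apply: (leq_trans (size_sum _ _ _)).
  apply/bigmax_leqP_seq => k _ kF; apply: leq_trans (size_scale_leq _ _) _.
  by rewrite size_polyXn ltnS; apply: Fd.
move=> t; rewrite /tuv_eval mevalE horner_sum; apply: eq_bigr => k _.
rewrite hornerZ hornerXn big_split_ord big_ord1 /= row_mxEl mxE eqxx mulr1n.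
rewrite -mulrA; congr (_ * _); rewrite mulrC; congr (_ * _).
by apply: eq_bigr => i _; rewrite row_mxEr.
Qed.

Lemma PD_fin (R : realType) (n m : nat) (A : 'M[R]_(n, m)) F (I : finType)
    (x : I -> 'cV[R]_n) : PD A F -> (forall i, sphere R n (x i)) ->
  psd (fun i j => F (triple A (x i) (x j))).
Proof.
case=> _ _ K xS; have [Ksym Kge0] := K #|I| (x \o enum_val) (fun i => xS _).
split=> [i j|c].
  by have := Ksym (enum_rank i) (enum_rank j); rewrite /= !enum_rankK.
have := Kge0 (c \o enum_val); congr (0 <= _).
rewrite [RHS](reindex (@enum_val I I)) /=; last by apply: onW_bij; apply: enum_val_bij.
apply: eq_bigr => i _.
by rewrite [RHS](reindex (@enum_val I I)) //=; apply: onW_bij; apply: enum_val_bij.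
Qed.

Lemma sum_pair (R : realType) (I J : finType) (f : I * J -> R) :
  \sum_q f q = \sum_i \sum_j f (i, j).
Proof. by rewrite pair_bigA; apply: eq_bigr => -[]. Qed.

(** The quadratic form at [c] is that of [K] at the vector with entries [c i * w i j]. *)
Lemma psd_compress (R : realType) (I J : finType) (K : I * J -> I * J -> R)
    (w : I -> J -> R) : psd K ->
  psd (fun i i' => \sum_j \sum_j' w i j * K (i, j) (i', j') * w i' j').
Proof.
case=> Ksym Kge0; split=> [i i'|c].
  rewrite exchange_big; apply: eq_bigr => j _; apply: eq_bigr => j' _ /=.
  by rewrite Ksym; ring.
have := Kge0 (fun q => c q.1 * w q.1 q.2); congr (0 <= _).
rewrite sum_pair; apply: eq_bigr => i _ /=.
under eq_bigr do rewrite sum_pair.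
rewrite exchange_big; apply: eq_bigr => i' _ /=.
rewrite mulr_sumr mulr_suml; apply: eq_bigr => j _.
rewrite mulr_sumr mulr_suml; apply: eq_bigr => j' _; ring.
Qed.

(** * Extraction of one coefficient matrix *)

Section CoefficientRecovery.
Variables (R : realType) (n m : nat) (A : 'M[R]_(n, m)).
Let G := A^T *m A.
Hypotheses (G_unit : G \in unitmx) (mn : (m + 2 <= n)%N).
Let hgt := hgt A.

(** [M u v] is a weighted sum of [F] over sample points above [u] and [v]. By [zonal_separation]
    only degree [l] survives, with a factor $(\sqrt{h_u}\sqrt{h_v})^l$ that is divided out. [M] is
    fixed first, while [f] may depend on the pair of labels. *)
Lemma extract_coef d l (F : R * 'cV[R]_m * 'cV[R]_m -> R) : PD A F -> (l < d)%N ->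
  exists M : 'cV[R]_m -> 'cV[R]_m -> R,
    (forall (I : finType) (u : I -> 'cV[R]_m), (forall i, 0 <= hgt (u i)) ->
      psd (fun i j => M (u i) (u j))) /\
    (forall u v (f : nat -> R), 0 <= hgt u -> 0 <= hgt v ->
      (forall t, F (t, u, v) = \sum_(j < d) Pnm n j G u v t * f j) ->
      (l = 0%N) \/ hgt u * hgt v != 0 -> M u v = f l).
Proof.
move=> F_PD ld.
have [k [c [x [xS Z]]]] :=
  zonal_separation (code_proj_sym A) (code_proj_idem G_unit) (code_proj_tr_gt1 G_unit mn) ld.
pose s u := Num.sqrt (hgt u) ^- l.
(* If [h_u = 0] and [l > 0] then [s u = 0^-1 = 0], so the matrix vanishes at the
   labels where the coefficient of degree [l] is not determined by [F]. *)
exists (fun u v => \sum_a \sum_b (s u * c a) *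
  F (triple A (lift_pt A u (x a)) (lift_pt A v (x b))) * (s v * c b)).
split=> [I u u0|u v f u0 v0 Ff uv].
  apply: (psd_compress (fun i a => s (u i) * c a) (K := fun p q =>
    F (triple A (lift_pt A (u p.1) (x p.2)) (lift_pt A (u q.1) (x q.2))))).
  apply: (PD_fin (x := fun p => lift_pt A (u p.1) (x p.2)) F_PD) => p.
  by apply: lift_pt_sphere.
transitivity (s u * s v * \sum_(j < d) f j * (Num.sqrt (hgt u) ^+ j * Num.sqrt (hgt v) ^+ j)
  * \sum_a \sum_b c a * zonal (code_proj A) j (x a) (x b) * c b).
  rewrite mulr_sumr.
  under [RHS]eq_bigr do rewrite !mulr_sumr.
  rewrite [RHS]exchange_big; apply: eq_bigr => a _ /=.
  under [RHS]eq_bigr do rewrite !mulr_sumr.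
  rewrite [RHS]exchange_big; apply: eq_bigr => b _ /=.
  rewrite triple_lift_pt // Ff mulr_sumr mulr_suml; apply: eq_bigr => j _.
  rewrite Pnm_lift_pt //; ring.
rewrite (bigD1 (Ordinal ld)) //= [X in _ * (_ + X)]big1 => [|j jl]; last first.
  by rewrite Z // -[val j == l]/(j == Ordinal ld) (negPf jl) mulr0.
rewrite Z // eqxx mulr1 addr0 /s.
case: uv => [->|uv]; first by rewrite !expr0 invr1 !mulr1 mul1r.
have [su sv] : Num.sqrt (hgt u) ^+ l != 0 /\ Num.sqrt (hgt v) ^+ l != 0.
  move: uv; rewrite mulf_eq0 negb_or => /andP[hu hv].
  by split; rewrite expf_neq0 // sqrtr_eq0 -ltNge lt_def ?hu ?hv.
by field; rewrite su sv.
Qed.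
End CoefficientRecovery.

(** * General and reference labels *)

Section Labels.
Variables (R : realType) (n m : nat) (L : {fset R}) (r : m.-tuple 'cV[R]_n).
Hypotheses (L_lt1 : forall a, a \in L -> a < 1) (r_free : free r)
  (r_sphere : forall x, x \in r -> sphere R n x).
Implicit Types (u v : 'cV[R]_m).

Lemma gram_unit : gram r \in unitmx.
Proof.
have inj (c : 'cV[R]_m) : gram r *m c = 0 -> c = 0.
  move=> Gc; have /eqP : dot (code_mx r *m c) (code_mx r *m c) = 0.
    by rewrite dot_mulmxl mulmxA -/(gram r) Gc /dot mulmx0 mxE.
  rewrite dot_eq0 => /eqP Ac; apply/matrixP => i j; rewrite (ord1 j) mxE.
  apply: (freeP r_free (fun i => c i 0)); apply/matrixP => k l.
  rewrite (ord1 l) -[RHS](congr1 (fun M : 'cV[R]_n => M k 0) Ac) summxE mxE.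
  by apply: eq_bigr => a _; rewrite !mxE (tnth_nth 0) mulrC.
have Gsym : (gram r)^T = gram r by rewrite /gram trmx_mul trmxK.
rewrite -row_free_unit -kermx_eq0; apply/eqP/row_matrixP => i; rewrite row0.
apply: trmx_inj; rewrite trmx0; apply: inj.
by rewrite -{1}Gsym -trmx_mul -row_mul mulmx_ker row0 trmx0.
Qed.

Lemma gram_diag i : gram r i i = 1.
Proof.
rewrite /gram mxE -(r_sphere (mem_tnth i r)) dotE; apply: eq_bigr => k _.
by rewrite !mxE.
Qed.

(** [G *m delta_mx i 0] is the label of the code point $r_i$, which has no component in W. *)
Lemma hgt_ref u : u \in ref_labels (gram r) -> hgt (code_mx r) u = 0.
Proof.
rewrite in_ref_labels => /existsP[i /eqP ->].
have Gsym : (gram r)^T = gram r by rewrite /gram trmx_mul trmxK.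
rewrite /hgt /ginv -/(gram r) trmx_mul Gsym mulmxK ?gram_unit //.
by rewrite trmx_delta mulmxA -rowE -colE [col _ _ _ _]mxE [row _ _ _ _]mxE gram_diag subrr.
Qed.

Lemma hgt_gen u : u \in gen_labels L (gram r) -> 0 <= hgt (code_mx r) u.
Proof. by rewrite in_gen_labels => /andP[]. Qed.

Lemma hgt_labels u : u \in labels L (gram r) -> 0 <= hgt (code_mx r) u.
Proof. by rewrite in_fsetU => /orP[/hgt_gen//|/hgt_ref ->]. Qed.

(** The [i]-th entry of $Ge_i$ is 1, which is not in [L]. *)
Lemma gen_not_ref u : u \in gen_labels L (gram r) -> u \notin ref_labels (gram r).
Proof.
rewrite in_gen_labels => /andP[/forallP uL _]; rewrite in_ref_labels.
apply/existsPn => i; apply/eqP => Eu; have := L_lt1 (uL i).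
by rewrite Eu -colE [col _ _ _ _]mxE gram_diag ltxx.
Qed.

Lemma in_labels u : (u \in labels L (gram r)) =
  (u \in gen_labels L (gram r)) || (u \in ref_labels (gram r)).
Proof. by rewrite in_fsetU. Qed.
End Labels.

(** * Polynomial functions and interpolation *)

Section PolynomialFunctions.
Variables (R : realType) (m : nat).
Let tuv := (R * 'cV[R]_m * 'cV[R]_m)%type.
Implicit Types (f g : tuv -> R) (d : nat).

(** Only the degree in [t] is tracked: degree 0 means polynomial in [u] and [v] alone. *)
Definition tuv_polyfun d f :=
  exists2 F : tuv_poly R m, tdeg_le d F & forall z, tuv_eval F z = f z.

Lemma polyfun_eq d f g : f =1 g -> tuv_polyfun d f -> tuv_polyfun d g.
Proof. by move=> fg [F Fd FE]; exists F => // z; rewrite FE fg. Qed.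

Lemma polyfunC d c : tuv_polyfun d (fun=> c).
Proof.
exists (mpolyC _ c) => [k|[[t u] v]]; last by rewrite /tuv_eval mevalC.
by rewrite msuppC; case: ifP => // _; rewrite inE => /eqP ->; rewrite mnm0E.
Qed.

Lemma polyfunX d (j : 'I_(1 + (m + m))) : (val j == 0%N <= d)%N ->
  tuv_polyfun d (fun z => row_mx z.1.1%:M (row_mx z.1.2^T z.2^T) 0 j).
Proof.
move=> jd; exists (mpolyX _ (mnm1 j)) => [k|[[t u] v]]; last by rewrite /tuv_eval mevalXU.
rewrite msuppX inE => /eqP ->; rewrite mnm1E; apply: leq_trans jd.
by rewrite -val_eqE.
Qed.

Lemma polyfun_t : tuv_polyfun 1 (fun z => z.1.1).
Proof.
apply: polyfun_eq (@polyfunX 1 (lshift _ ord0) _) => [z|]; last exact: leq_b1.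
by rewrite row_mxEl mxE eqxx mulr1n.
Qed.

Definition vec_polyfun (w : tuv -> 'cV[R]_m) :=
  forall i, tuv_polyfun 0 (fun z => w z i 0).

Lemma vec_polyfun_u : vec_polyfun (fun z => z.1.2).
Proof.
move=> i; apply: polyfun_eq (@polyfunX 0 (rshift 1 (lshift m i)) _) => // z.
by rewrite row_mxEr row_mxEl mxE.
Qed.

Lemma vec_polyfun_v : vec_polyfun (fun z => z.2).
Proof.
move=> i; apply: polyfun_eq (@polyfunX 0 (rshift 1 (rshift m i)) _) => // z.
by rewrite !row_mxEr mxE.
Qed.

Lemma polyfun_leq d d' f : (d <= d')%N -> tuv_polyfun d f -> tuv_polyfun d' f.
Proof. by move=> dd' [F Fd FE]; exists F => // k /Fd kd; apply: leq_trans dd'. Qed.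

Lemma polyfunD d f g : tuv_polyfun d f -> tuv_polyfun d g ->
  tuv_polyfun d (fun z => f z + g z).
Proof.
move=> [F Fd FE] [F' Fd' FE']; exists (F + F') => [k /msuppD_le|[[t u] v]].
  by rewrite mem_cat => /orP[/Fd|/Fd'].
by rewrite -FE -FE' /tuv_eval mevalD.
Qed.

Lemma polyfunM d d' f g : tuv_polyfun d f -> tuv_polyfun d' g ->
  tuv_polyfun (d + d') (fun z => f z * g z).
Proof.
move=> [F Fd FE] [F' Fd' FE']; exists (F * F') => [k /msuppM_le|[[t u] v]].
  move=> /allpairsP[[k1 k2] /= [/Fd k1d /Fd' k2d ->]].
  by rewrite mnmDE leq_add.
by rewrite -FE -FE' /tuv_eval mevalM.
Qed.

Lemma polyfunZ d c f : tuv_polyfun d f -> tuv_polyfun d (fun z => c * f z).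
Proof. by move/(polyfunM (polyfunC 0 c)). Qed.

Lemma polyfunB d f g : tuv_polyfun d f -> tuv_polyfun d g ->
  tuv_polyfun d (fun z => f z - g z).
Proof.
move=> fd /(polyfunZ (-1)) gd; apply: polyfun_eq (polyfunD fd gd) => z.
by rewrite mulN1r.
Qed.

Lemma polyfun_sum d (I : Type) (s : seq I) (f : I -> tuv -> R) :
  (forall i, tuv_polyfun d (f i)) -> tuv_polyfun d (fun z => \sum_(i <- s) f i z).
Proof.
move=> fd; elim: s => [|i s IH].
  by apply: polyfun_eq (polyfunC d 0) => z; rewrite big_nil.
by apply: polyfun_eq (polyfunD (fd i) IH) => z; rewrite big_cons.
Qed.

Lemma polyfun_ginv G w w' : vec_polyfun w -> vec_polyfun w' ->
  tuv_polyfun 0 (fun z => ginv G (w z) (w' z)).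
Proof.
move=> wp wp'; pose g z := \sum_i \sum_j w z i 0 * (invmx G i j * w' z j 0).
apply: (@polyfun_eq _ g) => [z|].
  rewrite /g /ginv -mulmxA mxE; apply: eq_bigr => i _; rewrite !mxE mulr_sumr.
  by [].
apply: polyfun_sum => i; apply: polyfun_sum => j.
by apply: (@polyfunM 0 0 _ _ (wp i)); apply: polyfunZ.
Qed.

(** In [t], $h_uh_v$ has degree 0 and $w$ has degree 1. *)
Lemma polyfun_Pnm n l G :
  tuv_polyfun l (fun z => Pnm n l G z.1.2 z.2 z.1.1).
Proof.
have pg w w' (wp : vec_polyfun w) (wp' : vec_polyfun w') := polyfun_ginv G wp wp'.
have h : tuv_polyfun 0 (fun z => (1 - ginv G z.1.2 z.1.2) * (1 - ginv G z.2 z.2)).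
  apply: (@polyfunM 0 0); apply: polyfunB (polyfunC 0 1) (pg _ _ _ _);
  by [apply: vec_polyfun_u|apply: vec_polyfun_v].
have w : tuv_polyfun 1 (fun z => z.1.1 - ginv G z.1.2 z.2).
  apply: polyfunB polyfun_t _; apply: polyfun_leq (leq0n 1) _.
  by apply: pg; [apply: vec_polyfun_u|apply: vec_polyfun_v].
elim/nat_ind2: l => [||k IH0 IH1]; [exact: polyfunC|exact: w|].
rewrite /Pnm /=; apply: polyfun_eq (polyfunZ ((k.+2%:R + (n%:R - m%:R) - 3)^-1)
  (polyfunB (polyfunZ (2 * k.+2%:R + (n%:R - m%:R) - 4) (polyfunM w IH1))
    (polyfunZ (k.+2%:R - 1) (polyfun_leq (leqW (leqnSn k)) (polyfunM h IH0))))).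
by move=> z; rewrite /Pnm /=; ring.
Qed.

Lemma continuous_tuv_eval (F : tuv_poly R m) : continuous (tuv_eval F).
Proof.
have ceq (f g : R * 'cV[R]_m * 'cV[R]_m -> R) : continuous f -> g =1 f -> continuous g.
  by move=> cf /funext ->.
have ct : continuous (fun z : R * 'cV[R]_m * 'cV[R]_m => z.1.1).
  by move=> z; apply: (@continuous_comp _ _ _ fst fst); exact: cvg_fst.
have cu i : continuous (fun z : R * 'cV[R]_m * 'cV[R]_m => z.1.2 i 0).
  move=> z; apply: (@continuous_comp _ _ _ (fun z : R * 'cV[R]_m * 'cV[R]_m => z.1.2)
    (fun u : 'cV[R]_m => u i 0) z); last exact: coord_continuous.
  by apply: (@continuous_comp _ _ _ fst snd); [exact: cvg_fst|exact: cvg_snd].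
have cv i : continuous (fun z : R * 'cV[R]_m * 'cV[R]_m => z.2 i 0).
  move=> z; apply: (@continuous_comp _ _ _ (fun z : R * 'cV[R]_m * 'cV[R]_m => z.2)
    (fun u : 'cV[R]_m => u i 0) z); last exact: coord_continuous.
  exact: cvg_snd.
have cj (j : 'I_(1 + (m + m))) : continuous (fun z : tuv =>
    row_mx z.1.1%:M (row_mx z.1.2^T z.2^T) 0 j).
  rewrite -(splitK j); case: (fintype.split j) => [i|i] /=.
    by apply: ceq ct _ => z; rewrite (ord1 i) row_mxEl mxE eqxx mulr1n.
  rewrite -(splitK i); case: (fintype.split i) => {}i /=.
    by apply: ceq (cu i) _ => z; rewrite row_mxEr row_mxEl mxE.
  by apply: ceq (cv i) _ => z; rewrite !row_mxEr mxE.
have cX (f : tuv -> R) e : continuous f -> continuous (fun z => f z ^+ e).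
  move=> cf; elim: e => [|e IH].
    by apply: (ceq (fun=> 1)) => z; [exact: cvg_cst|];  rewrite expr0.
  apply: (ceq (f \* (fun z => f z ^+ e))) => z; last by rewrite exprS.
  by apply: continuousM; [apply: cf|apply: IH].
have cprod (k : multinom (1 + (m + m))) (s : seq 'I_(1 + (m + m))) : continuous (fun z : tuv =>
    \prod_(j <- s) row_mx z.1.1%:M (row_mx z.1.2^T z.2^T) 0 j ^+ k j).
  elim: s => [|j s IH].
    by apply: (ceq (fun=> 1)) => z; [exact: cvg_cst|];  rewrite big_nil.
  apply: (ceq ((fun z : tuv => row_mx z.1.1%:M (row_mx z.1.2^T z.2^T) 0 j ^+ k j)
    \* (fun z => \prod_(j <- s) row_mx z.1.1%:M (row_mx z.1.2^T z.2^T) 0 j ^+ k j))) => z;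
    last by rewrite big_cons.
  by apply: continuousM; [apply: cX|apply: IH].
pose mon (k : multinom (1 + (m + m))) (z : tuv) := mcoeff k F * \prod_(j < 1 + (m + m))
    row_mx z.1.1%:M (row_mx z.1.2^T z.2^T) 0 j ^+ k j.
have csum (s : seq (multinom (1 + (m + m)))) : continuous (fun z => \sum_(k <- s) mon k z).
  elim: s => [|k s IH].
    by apply: (ceq (fun=> 0)) => z; [exact: cvg_cst|];  rewrite big_nil.
  apply: (ceq (mon k + (fun z => \sum_(k <- s) mon k z))) => z; last by rewrite big_cons.
  apply: continuousD; last exact: IH.
  by apply: continuousM; [exact: cvg_cst|exact: cprod].
by apply: ceq (csum (msupp F)) _ => -[[t u] v]; rewrite /tuv_eval mevalE.
Qed.
End PolynomialFunctions.

(** * Lagrange interpolation of matrices indexed by labels *)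

Section Interpolation.
Variables (R : realType) (m : nat).
Implicit Types (u v a b : 'cV[R]_m) (s : seq 'cV[R]_m).

(** In several variables $|u-b|^2$ replaces the linear factor: it is a polynomial vanishing exactly
    at $b$. *)
Definition lagrange s a u : R :=
  \prod_(b <- s | b != a) (dot (u - b) (u - b) / dot (a - b) (a - b)).

Lemma lagrangeE s a u : u \in s -> lagrange s a u = (u == a)%:R.
Proof.
move=> us; have [->|ua] := eqVneq u a.
  rewrite /lagrange big1 // => b ba; rewrite divff // dot_eq0 subr_eq0 eq_sym //.
apply/eqP; rewrite prodf_seq_eq0; apply/hasP; exists u => //=.
by rewrite ua subrr /dot mulmx0 mxE mul0r eqxx.
Qed.

Lemma polyfun_lagrange s a w : vec_polyfun w ->
  tuv_polyfun 0 (fun z => lagrange s a (w z)).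
Proof.
move=> wp; rewrite /lagrange; elim: s => [|b s IH].
  by apply: polyfun_eq (polyfunC m 0 1) => z; rewrite big_nil.
case ba: (b != a); last first.
  by apply: polyfun_eq IH => z; rewrite big_cons ba.
have wb i : tuv_polyfun 0 (fun z => w z i 0 - b i 0).
  exact: polyfunB (wp i) (polyfunC m 0 _).
have dp : tuv_polyfun 0 (fun z => \sum_i (w z i 0 - b i 0) * (w z i 0 - b i 0)).
  by apply: polyfun_sum => i; apply: (@polyfunM _ _ 0 0).
apply: polyfun_eq (@polyfunM _ _ 0 0 _ _ (polyfunZ (dot (a - b) (a - b))^-1 dp) IH) => z.
rewrite big_cons ba; congr (_ * _); rewrite mulrC [dot (w z - b) _]dotE; congr (_ / _).
by apply: eq_bigr => i _; rewrite !mxE.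
Qed.

Lemma sum_fset_pick (E : {fset 'cV[R]_m}) (f : 'cV[R]_m -> R) u :
  \sum_(a : E) f (val a) * (u == val a)%:R = if u \in E then f u else 0.
Proof.
case: ifPn => uE.
  rewrite (bigD1 [` uE]%fset) //= eqxx mulr1 big1 ?addr0 // => a.
  by rewrite -val_eqE eq_sym => /negPf /= ->; rewrite mulr0.
rewrite big1 // => a _; case: eqP => [ua|]; last by rewrite mulr0.
by rewrite ua (valP a) in uE.
Qed.

Definition interp s (E : {fset 'cV[R]_m}) (M : 'cV[R]_m -> 'cV[R]_m -> R) u v : R :=
  \sum_(a : E) \sum_(b : E)
    lagrange s (val a) u * M (val a) (val b) * lagrange s (val b) v.

Lemma interpE s E M u v : u \in s -> v \in s ->
  interp s E M u v = if (u \in E) && (v \in E) then M u v else 0.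
Proof.
move=> us vs; rewrite /interp.
transitivity (\sum_(a : E) (if v \in E then M (val a) v else 0) * (u == val a)%:R).
  apply: eq_bigr => a _; rewrite -(sum_fset_pick E (M (val a))) mulr_suml.
  by apply: eq_bigr => b _; rewrite !lagrangeE //; ring.
rewrite (sum_fset_pick E (fun a => if v \in E then M a v else 0)).
by case: (u \in E).
Qed.

Lemma polyfun_interp s E M :
  tuv_polyfun 0 (fun z => interp s E M z.1.2 z.2).
Proof.
apply: polyfun_sum => a; apply: polyfun_sum => b.
apply: (@polyfunM _ _ 0 0); last exact: polyfun_lagrange (@vec_polyfun_v _ _).
apply: (@polyfunM _ _ 0 0); last exact: polyfunC.
exact: polyfun_lagrange (@vec_polyfun_u _ _).
Qed.
End Interpolation.

(** * Stability of positive semidefiniteness *)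

Lemma psd_congruence (R : realType) (I J : finType) (M : J -> J -> R) (w : I -> J -> R) :
  psd M -> psd (fun i i' => \sum_j \sum_j' w i j * M j j' * w i' j').
Proof.
case=> Msym Mge0; split=> [i i'|c].
  rewrite exchange_big; apply: eq_bigr => j _; apply: eq_bigr => j' _ /=.
  by rewrite Msym; ring.
have := Mge0 (fun j => \sum_i c i * w i j); congr (0 <= _).
transitivity (\sum_j \sum_j' \sum_i \sum_i' c i * w i j * M j j' * (c i' * w i' j')).
  apply: eq_bigr => j _; apply: eq_bigr => j' _; rewrite mulr_suml mulr_suml.
  by apply: eq_bigr => i _; rewrite mulr_sumr.
transitivity (\sum_i \sum_i' \sum_j \sum_j' c i * w i j * M j j' * (c i' * w i' j')).
  under eq_bigr do rewrite exchange_big; rewrite exchange_big; apply: eq_bigr => i _ /=.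
  under eq_bigr do rewrite exchange_big; by rewrite exchange_big.
apply: eq_bigr => i _; apply: eq_bigr => i' _.
rewrite mulr_sumr mulr_suml; apply: eq_bigr => j _.
rewrite mulr_sumr mulr_suml; apply: eq_bigr => j' _; ring.
Qed.

Lemma psd_sum (R : realType) (I K : finType) (M : K -> I -> I -> R) :
  (forall k, psd (M k)) -> psd (fun i j => \sum_k M k i j).
Proof.
move=> Mp; split=> [i j|c]; first by apply: eq_bigr => k _; case: (Mp k).
rewrite (_ : \sum_i _ = \sum_k \sum_i \sum_j c i * M k i j * c j).
  by apply: sumr_ge0 => k _; case: (Mp k).
rewrite [RHS]exchange_big; apply: eq_bigr => i _ /=.
rewrite [RHS]exchange_big; apply: eq_bigr => j _ /=.
by rewrite mulr_sumr mulr_suml.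
Qed.

(** * Equivalence of polynomial kernels and coefficient matrices *)

Theorem theorem5 (R : realType) (n m d : nat) (L : {fset R})
    (r : m.-tuple 'cV[R]_n)
    (F0 : R * 'cV[R]_m * 'cV[R]_m -> R)
    (n_ge2 : (2 <= n)%N)
    (L_neq0 : L != fset0)
    (L_sub : forall a, a \in L -> -1 <= a < 1)
    (r_uniq : uniq r)
    (r_code : spherical_code L r)
    (r_free : free r)
    (m_le : (m <= n - 2)%N) :
  (exists F : tuv_poly R m,
    [/\ tdeg_le d F,
        PD (code_mx r) (tuv_eval F)
      & forall z, Omega L (gram r) z -> F0 z = tuv_eval F z])
  <->
  (* [M l] is only read on [labels L G] for l = 0 and on [gen_labels L G] for
     l > 0; its restriction there is the matrix M_{R,l}. *)
  (exists M : nat -> 'cV[R]_m -> 'cV[R]_m -> R,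
    [/\ psd (fun a b : labels L (gram r) => M 0%N (val a) (val b)),
        forall l, (1 <= l <= d)%N ->
          psd (fun a b : gen_labels L (gram r) => M l (val a) (val b))
      & forall t u v, Omega L (gram r) (t, u, v) ->
          F0 (t, u, v) =
          \sum_(0 <= l < d.+1)
            if (0 < l)%N &&
               ((u \in ref_labels (gram r)) || (v \in ref_labels (gram r)))
            then 0
            else Pnm n l (gram r) u v t * M l u v]).
Proof.
have mn : (m + 2 <= n)%N by rewrite addnC -leq_subRL.
have r_sphere := proj1 r_code.
have L_lt1 a : a \in L -> a < 1 by case/L_sub/andP.
have G_unit : gram r \in unitmx := gram_unit r_free.
have P_gt1 := code_proj_tr_gt1 G_unit mn.
have Psym := code_proj_sym (code_mx r).
have Pidem := code_proj_idem G_unit.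
have h_ge0 := hgt_labels (L := L) r_free r_sphere.
split.
- move=> [F [Fd F_PD FE]].
  (* Each matrix function is chosen before any labels are given; beyond degree [d] it is set to zero
     so that the choice covers every [l]. *)
  have /choice[M HM] l : exists Ml : 'cV[R]_m -> 'cV[R]_m -> R, (l < d.+1)%N ->
    (forall (I : finType) (u : I -> 'cV[R]_m), (forall i, 0 <= hgt (code_mx r) (u i)) ->
      psd (fun i j => Ml (u i) (u j))) /\
    (forall u v (f : nat -> R), 0 <= hgt (code_mx r) u -> 0 <= hgt (code_mx r) v ->
      (forall t, tuv_eval F (t, u, v) = \sum_(j < d.+1) Pnm n j (gram r) u v t * f j) ->
      (l = 0%N) \/ hgt (code_mx r) u * hgt (code_mx r) v != 0 -> Ml u v = f l).
    have [ld|_] := boolP (l < d.+1)%N; last by exists (fun _ _ => 0).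
    by have [Ml HMl] := extract_coef G_unit mn F_PD ld; exists Ml.
  exists M; split=> [|l /andP[_ ld]|t u v zO].
  + by apply: (proj1 (HM 0%N isT)) => i; apply: h_ge0; apply: valP.
  + by apply: (proj1 (HM l ld)) => i; apply: (@hgt_gen _ _ _ L); apply: valP.
  have [_ uU vU Hpsd] := zO; rewrite FE //.
  have [q qd Eq] := tuv_eval_poly u v Fd.
  have [f Ef] := gegenbauer_expansion (hgt (code_mx r) u * hgt (code_mx r) v)
    (ginv (gram r) u v) P_gt1 qd.
  have EF t' : tuv_eval F (t', u, v) = \sum_(j < d.+1) Pnm n j (gram r) u v t' * f j.
    by rewrite Eq Ef code_proj_tr.
  rewrite EF big_mkord; apply: eq_bigr => l _.
  have HMl := (proj2 (HM l (ltn_ord l))) u v f (h_ge0 u uU) (h_ge0 v vU) EF.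
  case: (posnP l) => [l0|l_gt0] /=; first by rewrite HMl //; left.
  (* If $h_uh_v=0$, both sides vanish in positive degree because the triple is feasible. Otherwise
     neither label is a reference label, and the coefficient is recovered. *)
  have [uv0|uv0] := eqVneq (hgt (code_mx r) u * hgt (code_mx r) v) 0.
    have P0 : Pnm n l (gram r) u v t = 0.
      by rewrite -(prednK l_gt0); apply: (Pnm_degenerate G_unit mn).
    by rewrite P0 !mul0r if_same.
  case: ifP => [/orP[] /(hgt_ref r_free r_sphere) h0|_].
  + by rewrite h0 mul0r eqxx in uv0.
  + by rewrite h0 mulr0 eqxx in uv0.
  by rewrite HMl //; right.
move=> [M [M0 Ml ME]].
pose U := labels L (gram r); pose s : seq 'cV[R]_m := U.
pose E l := if (l == 0)%N then U else gen_labels L (gram r).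
have psdM l : (l <= d)%N -> psd (fun a b : E l => M l (val a) (val b)).
  by case: l => [//|l] ld; apply: Ml.
(* Interpolation at all labels makes the matrices polynomial in [u] and [v]. For [l > 0] the index
   set omits the reference labels, which yields the convention that these summands are 0. *)
pose f z := \sum_(l < d.+1) Pnm n l (gram r) z.1.2 z.2 z.1.1 * interp s (E l) (M l) z.1.2 z.2.
have [F Fd FE] : tuv_polyfun d f.
  apply: polyfun_sum => l; rewrite -[X in tuv_polyfun X]addn0.
  apply: polyfunM (@polyfun_interp _ _ _ _ _).
  by apply: polyfun_leq (polyfun_Pnm _ _ _); rewrite -ltnS.
have Fpsd (I : finType) (x : I -> 'cV[R]_n) : (forall i, sphere R n (x i)) ->
    psd (fun i j => tuv_eval F (triple (code_mx r) (x i) (x j))).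
  (* On the sphere each summand is a zonal kernel times a congruence of [M l], hence a Schur product
     of positive kernels. *)
  move=> xS; rewrite (_ : (fun i j => _) = fun i j => \sum_(l < d.+1)
      zonal (code_proj (code_mx r)) l (x i) (x j) *
      interp s (E l) (M l) ((code_mx r)^T *m x i) ((code_mx r)^T *m x j)).
    apply: psd_sum => l; apply: psd_zonal_mul => //.
    by apply: psd_congruence; apply: psdM; rewrite -ltnS.
  apply/funext => i; apply/funext => j; rewrite FE /f; apply: eq_bigr => l _ /=.
  by rewrite Pnm_sphere //; apply: xS.
have F_PD : PD (code_mx r) (tuv_eval F).
  split=> [|t u v|N x]; last exact: Fpsd.
    by apply: continuous_subspaceT; apply: continuous_tuv_eval.
  move=> [x xS [y yS [<- <- <-]]].
  (* The symmetry of [F] on the domain is that of its matrix at the two points [x] and [y]. *)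
  have [|Fsym _] := Fpsd _ (fun i : bool => if i then x else y); first by case.
  by rewrite [in RHS]dotC; apply: (Fsym true false).
exists F; split=> //.
move=> [[t u] v] zO; have [_ uU vU _] := zO.
rewrite ME // FE /f big_mkord; apply: eq_bigr => l _ /=; rewrite interpE //.
case: (posnP l) => [->|l_gt0] /=; first by rewrite /E eqxx uU vU.
rewrite /E gtn_eqF //.
have genE w : w \in U -> (w \in gen_labels L (gram r)) = (w \notin ref_labels (gram r)).
  move=> wU; apply/idP/idP => [|wref]; first exact: gen_not_ref.
  by move: wU; rewrite in_labels (negPf wref) orbF.
rewrite !genE // -negb_or; case: ifP => //=.
by rewrite mulr0.
Qed.
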